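(* Let $G$ be a group, $K$ a complete, non-discretely valued field and $d\geq 1$ an integer, with $d<\mathrm{char}(K)$ if $\mathrm{char}(K)>0$. Let $(\rho_n)_{n\in\mathbb{N}}$ be a sequence of representations $\rho_n\colon G\to \mathrm{GL}_d(K)$ which is trace-convergent, and let $\rho\colon G\to\mathrm{GL}_d(\overline{K})$ be its limit representation. Assume that $\rho$ is irreducible. Then the representations $\rho_n$ are absolutely irreducible for all $n$ large enough, $(\rho_n)$ is physically convergent, and $\rho$ is defined over $K$ (i.e. is conjugate to a representation with values in $\mathrm{GL}_d(K)$). If moreover $(\rho_n)$ is uniformly trace-convergent, then it is uniformly physically convergent.
   Context: $\overline{K}$ is an algebraic closure of $K$. The sequence $(\rho_n)$ is trace-convergent if for every $g\in G$ the sequence $\mathrm{tr}(\rho_n(g))$ converges in $K$; it is uniformly trace-convergent if the functions $g\mapsto \mathrm{tr}(\rho_n(g))$ converge uniformly on $G$. It is physically convergent if for each $n$ there is a $K$-basis of $K^d$ such that, writing $c^n_{i,j}(g)$ for the matrix coefficients of $\rho_n(g)$ in this basis, the sequence $(c^n_{i,j}(g))_n$ converges in $K$ for every $g\in G$ and all $i,j$; it is uniformly physically convergent if moreover the functions $c^n_{i,j}$ converge uniformly on $G$. If $(\rho_n)$ is trace-convergent, $T(g):=\lim_n \mathrm{tr}(\rho_n(g))$ is a $d$-dimensional pseudo-character, and the limit representation $\rho$ is the (unique up to isomorphism) semisimple representation $G\to\mathrm{GL}_d(\overline{K})$ with trace $T$. *)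

(* Defs.v *)
From HB Require Import structures.
From mathcomp Require Import all_boot all_order all_algebra.
From mathcomp Require Import all_classical all_reals topology.

Set Implicit Arguments.
Unset Strict Implicit.
Unset Printing Implicit Defensive.

Import Order.TTheory GRing.Theory Num.Theory.

Local Open Scope classical_set_scope.
Local Open Scope ring_scope.

(* A field with a real-valued absolute value, archimedean or not, carrying the
   induced metric.  The norm of [normedZmodType] is unsuitable here: its axiom
   [`|x *+ n| = `|x| *+ n] excludes ultrametric and positive-characteristic
   fields. *)
HB.mixin Record PseudoMetricField_isValued (R : realType) K
    & GRing.Field K & PseudoMetric R K := {
  absv : K -> R;
  absv_ge0 : forall x, 0 <= absv x;
  absv_eq0 : forall x, absv x = 0 <-> x = 0;
  absvM : forall x y, absv (x * y) = absv x * absv y;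
  ler_absvD : forall x y, absv (x + y) <= absv x + absv y;
  ball_absvE : forall (x : K) (e : R) (y : K), ball x e y <-> absv (x - y) < e
}.

#[short(type="completeValuedFieldType")]
HB.structure Definition CompleteValuedField (R : realType) :=
  { K of GRing.Field K & PseudoMetric R K & Complete K
       & PseudoMetricField_isValued R K }.

Definition nontrivially_valued (R : realType) (K : completeValuedFieldType R) :=
  exists x : K, x != 0 /\ absv x != 1.

Definition algebraic_closure (K : fieldType) (L : closedFieldType)
    (iota : {rmorphism K -> L}) :=
  forall x : L, algebraicOver iota x.

Section Representations.
Variables (G : groupType) (d : nat).

Record representation (F : fieldType) := Representation {
  repr_mx :> G -> 'M[F]_d;
  repr_mx1 : repr_mx 1%g = 1%:M;
  repr_mxM : forall x y, repr_mx (x * y)%g = repr_mx x *m repr_mx y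
}.

(* Hence a [representation] is a homomorphism to GL_d(F). *)
Lemma repr_mx_unit (F : fieldType) (rho : representation F) g :
  rho g \in unitmx.
Proof.
by have /mulmx1_unit[] : rho g *m rho g^-1%g = 1%:M
  by rewrite -repr_mxM mulgV repr_mx1.
Qed.

(* The group acts on column vectors by left multiplication. *)
Definition invariant_sub (F : fieldType) (rho : representation F)
    (U : {vspace 'cV[F]_d}) :=
  forall g v, v \in U -> rho g *m v \in U.

Definition irreducible_sub (F : fieldType) (rho : representation F)
    (U : {vspace 'cV[F]_d}) :=
  [/\ invariant_sub rho U, U <> 0%VS
    & forall V, invariant_sub rho V -> (V <= U)%VS -> V = 0%VS \/ V = U].

Definition irreducible (F : fieldType) (rho : representation F) :=
  irreducible_sub rho fullv.

Definition semisimple (F : fieldType) (rho : representation F) :=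
  exists (m : nat) (U : 'I_m -> {vspace 'cV[F]_d}),
    [/\ forall i, irreducible_sub rho (U i),
        directv (\sum_i U i)%VS & (\sum_i U i)%VS = fullv].

Lemma map_repr1 (F E : fieldType) (f : {rmorphism F -> E})
    (rho : representation F) : map_mx f (rho 1%g) = 1%:M.
Proof. by rewrite repr_mx1 map_mx1. Qed.

Lemma map_reprM (F E : fieldType) (f : {rmorphism F -> E})
    (rho : representation F) x y :
  map_mx f (rho (x * y)%g) = map_mx f (rho x) *m map_mx f (rho y).
Proof. by rewrite repr_mxM map_mxM. Qed.

Definition extend_scalars (F E : fieldType) (f : {rmorphism F -> E})
    (rho : representation F) : representation E :=
  Representation (map_repr1 f rho) (map_reprM f rho).

Definition absolutely_irreducible (F : fieldType) (rho : representation F) :=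
  forall (E : fieldType) (f : {rmorphism F -> E}),
    irreducible (extend_scalars f rho).

(* [conj_mx P A] is the matrix of [A] in the basis formed by the columns
   of [P]. *)
Definition conj_mx (F : fieldType) (P A : 'M[F]_d) : 'M[F]_d :=
  invmx P *m A *m P.

Definition defined_over (F E : fieldType) (f : {rmorphism F -> E})
    (rho : representation E) :=
  exists (rho0 : representation F) (P : 'M[E]_d),
    P \in unitmx /\ forall g, conj_mx P (rho g) = extend_scalars f rho0 g.

End Representations.

Section Convergence.
Variables (R : realType) (K : completeValuedFieldType R).
Variables (G : groupType) (d : nat).
Implicit Types (rhos : nat -> representation G d K).

Definition trace_convergent rhos :=
  forall g, cvg (\tr (rhos n g) @[n --> \oo]).

Definition uniformly_trace_convergent rhos :=
  exists T : G -> K, {uniform, (fun n g => \tr (rhos n g)) @ \oo --> T}.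

Definition physically_convergent rhos :=
  exists P : nat -> 'M[K]_d, (forall n, P n \in unitmx) /\
    forall g i j, cvg (conj_mx (P n) (rhos n g) i j @[n --> \oo]).

Definition uniformly_physically_convergent rhos :=
  exists P : nat -> 'M[K]_d, (forall n, P n \in unitmx) /\
    forall i j, exists c : G -> K,
      {uniform, (fun n g => conj_mx (P n) (rhos n g) i j) @ \oo --> c}.

Definition limit_trace rhos (g : G) : K := lim (\tr (rhos n g) @[n --> \oo]).

(* Meaningful when [rhos] is trace-convergent and [iota] is an algebraic
   closure of [K]. *)
Definition limit_representation (L : closedFieldType)
    (iota : {rmorphism K -> L}) rhos (rho : representation G d L) :=
  semisimple rho /\ forall g, \tr (rho g) = iota (limit_trace rhos g).

End Convergence.

(* Main.v *)
Require Import Defs.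
From HB Require Import structures.
From mathcomp Require Import all_boot all_order all_algebra.
From mathcomp Require Import all_classical all_reals topology.
From mathcomp Require Import ring lra.

Set Implicit Arguments.
Unset Strict Implicit.
Unset Printing Implicit Defensive.

Import Order.TTheory GRing.Theory Num.Theory.

Local Open Scope classical_set_scope.
Local Open Scope ring_scope.

(* By Burnside's theorem some rho(g_i), i < d^2, form a basis of M_d, and their
   Gram matrix (T(g_i g_j)) is invertible.  Hence for n large the rho_n(g_i) are
   also a basis, and the coordinates of rho_n(g) in it, as well as the structure
   constants of the algebra A_n = span rho_n(G) = M_d(K), are rational functions
   of traces, so they converge; the limit structure constants are those of a
   K-form A of M_d.  As d is invertible in K, the inverse Gram matrix divided by
   d gives a separability idempotent of A, with which Newton's method deforms the
   approximately multiplicative map A -> A_n, rho(g_i) |-> rho_n(g_i), into an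
   algebra morphism f_n, the deformation tending to 0 with n.  Thus A is split,
   and by Skolem-Noether the f_n differ from a fixed f_m by conjugations, which
   conjugate rho_n to a convergent sequence.

   All limits are uniform as soon as T is bounded.  If T is unbounded and
   tr rho_n - T is bounded, then ker rho_n acts by zero in the limit (otherwise
   the two-sided ideal it generates is everything and T is bounded), so rho_n is
   conjugate to the limit. *)

(** * Skolem-Noether and Burnside theorems *)

Section LinearCombinations.
Variables (F : fieldType) (n d : nat).
Implicit Types (X : 'I_n -> 'M[F]_d) (x y : 'rV[F]_n).

Definition lincomb X x : 'M[F]_d := \sum_k x 0 k *: X k.

Definition fam_mx X : 'M[F]_(n, d * d) := \matrix_k mxvec (X k).

(** Multiplication, in coordinates, of the algebra with basis [e_i] and structure constants
    [e_i e_j = c i j]. *)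
Definition mulc (c : 'I_n -> 'I_n -> 'rV[F]_n) x y : 'rV[F]_n :=
  \sum_i \sum_j (x 0 i * y 0 j) *: c i j.

Lemma mxvec_lincomb X x : mxvec (lincomb X x) = x *m fam_mx X.
Proof.
rewrite linear_sum mulmx_sum_row; apply: eq_bigr => k _.
by rewrite linearZ rowK.
Qed.

Lemma lincomb_is_linear X : linear (lincomb X).
Proof.
move=> a x y; rewrite /lincomb scaler_sumr -big_split; apply: eq_bigr => k _ /=.
by rewrite !mxE scalerDl scalerA.
Qed.

HB.instance Definition _ X :=
  GRing.isLinear.Build F 'rV[F]_n 'M[F]_d *:%R (lincomb X) (lincomb_is_linear X).

Lemma lincomb_delta X k : lincomb X (delta_mx 0 k) = X k.
Proof.
rewrite /lincomb (bigD1 k) //= mxE !eqxx scale1r big1 ?addr0 // => j njk.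
by rewrite mxE eqxx (negPf njk) scale0r.
Qed.

Lemma lincombM X c x y :
  (forall i j, X i *m X j = lincomb X (c i j)) ->
  lincomb X (mulc c x y) = lincomb X x *m lincomb X y.
Proof.
move=> XM; rewrite linear_sum /= [in RHS]/lincomb mulmx_suml.
apply: eq_bigr => i _; rewrite linear_sum mulmx_sumr; apply: eq_bigr => j _.
by rewrite linearZ /= -XM -scalemxAl -scalemxAr scalerA.
Qed.

End LinearCombinations.

Lemma fam_mx_inj (F : fieldType) d (X : 'I_(d * d) -> 'M[F]_d) :
  fam_mx X \in unitmx -> injective (lincomb X).
Proof.
move=> uX x y /(congr1 mxvec); rewrite !mxvec_lincomb.
by move/(congr1 (mulmx^~ (invmx (fam_mx X)))); rewrite !mulmxK.
Qed.

Definition coords (F : fieldType) d (X : 'I_(d * d) -> 'M[F]_d) A : 'rV[F]_(d * d) :=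
  mxvec A *m invmx (fam_mx X).

Lemma coords_is_linear (F : fieldType) d (X : 'I_(d * d) -> 'M[F]_d) :
  linear (coords X).
Proof. by move=> a A B; rewrite /coords linearP mulmxDl scalemxAl. Qed.

HB.instance Definition _ (F : fieldType) d (X : 'I_(d * d) -> 'M[F]_d) :=
  GRing.isLinear.Build F 'M[F]_d 'rV[F]_(d * d) *:%R (coords X)
    (coords_is_linear X).

Lemma lincombK (F : fieldType) d (X : 'I_(d * d) -> 'M[F]_d) :
  fam_mx X \in unitmx -> cancel (lincomb X) (coords X).
Proof. by move=> uX x; rewrite /coords mxvec_lincomb mulmxK. Qed.

Lemma coordsK (F : fieldType) d (X : 'I_(d * d) -> 'M[F]_d) :
  fam_mx X \in unitmx -> cancel (coords X) (lincomb X).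
Proof.
move=> uX A; apply: (can_inj mxvecK).
by rewrite mxvec_lincomb mulmxKV.
Qed.

(** A nonzero entry of [M] thus puts every elementary matrix into the two-sided ideal generated by
    [M]. *)
Lemma delta_mx_sandwich (F : fieldType) d (M : 'M[F]_d) (a b k l : 'I_d) :
  delta_mx a k *m M *m delta_mx l b = M k l *: delta_mx a b.
Proof.
apply/matrixP => i j; rewrite !mxE (bigD1 l) //= big1 ?addr0; last first.
  by move=> m nml; rewrite !mxE (negPf nml) mulr0.
rewrite !mxE eqxx (bigD1 k) //= big1 ?addr0; last first.
  by move=> m nmk; rewrite !mxE (negPf nmk) andbF mul0r.
rewrite mxE eqxx andbT; case: (i == a); rewrite /= ?mul0r ?mulr0 //.
by rewrite mul1r.
Qed.

(* Skolem-Noether: writing phi for the linear map X i |-> Y i, the matrix P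
   has as its columns the vectors phi (E_{a k0}) e_j, for a fixed j such that
   phi (E_{k0 k0}) e_j is nonzero. *)
Lemma skolem_noether (F : fieldType) d (X Y : 'I_(d * d) -> 'M[F]_d)
    (c : 'I_(d * d) -> 'I_(d * d) -> 'rV[F]_(d * d)) (i0 : 'I_(d * d)) :
  fam_mx X \in unitmx -> X i0 = 1%:M -> Y i0 = 1%:M ->
  (forall i j, X i *m X j = lincomb X (c i j)) ->
  (forall i j, Y i *m Y j = lincomb Y (c i j)) ->
  exists2 P, P \in unitmx & forall i, Y i *m P = P *m X i.
Proof.
move=> uX X1 Y1 XM YM; pose phi A := lincomb Y (coords X A).
have phiX i : phi (X i) = Y i.
  by rewrite /phi -[X i]lincomb_delta lincombK // lincomb_delta.
have phiM A B : phi (A *m B) = phi A *m phi B.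
  rewrite /phi -{1}(coordsK uX A) -{1}(coordsK uX B) -(lincombM _ _ XM).
  by rewrite lincombK // (lincombM _ _ YM).
have phi1 : phi 1%:M = 1%:M by rewrite -{1}X1 phiX.
(* Splitting [i0] supplies an index [k0] below [d], so that [d] is positive. *)
have [k0 _] := mxvec_indexP i0.
have phi0 : phi 0 = 0 by rewrite /phi !linear0.
have phiE0 : phi (delta_mx k0 k0) != 0.
  apply/eqP => E0.
  have /matrixP/(_ k0 k0) : (1%:M : 'M[F]_d) = 0.
    rewrite -phi1 mx1_sum_delta /phi !linear_sum big1 // => a _.
    have -> : delta_mx a a = delta_mx a k0 *m delta_mx k0 k0 *m delta_mx k0 a :> 'M[F]_d.
      by rewrite delta_mx_sandwich mxE !eqxx scale1r.
    by rewrite -[LHS]/(phi _) !phiM E0 mulmx0 mul0mx.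
  by rewrite !mxE eqxx => /eqP; rewrite oner_eq0.
have [j colj] : exists j, col j (phi (delta_mx k0 k0)) != 0.
  apply/existsP; apply: contraNT phiE0 => /existsPn cols0.
  apply/eqP/matrixP => a b; move/negPn/eqP/colP/(_ a): (cols0 b).
  by rewrite !mxE.
pose P := \matrix_(i, a) phi (delta_mx a k0) i j.
(* The matrices [delta_mx a k0] span a left ideal on which [A] acts as it does on column vectors. *)
have phiP A : phi A *m P = P *m A.
  apply/matrixP => i a; rewrite !mxE.
  transitivity (phi (A *m delta_mx a k0) i j).
    by rewrite phiM mxE; apply: eq_bigr => b _; rewrite mxE.
  have -> : A *m delta_mx a k0 = \sum_b A b a *: delta_mx b k0.
    rewrite {1}[A]matrix_sum_delta mulmx_suml; apply: eq_bigr => b _.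
    rewrite mulmx_suml (bigD1 a) //= big1 ?addr0.
      by rewrite -scalemxAl mul_delta_mx.
    by move=> b' nb'; rewrite -scalemxAl mul_delta_mx_0 // scaler0.
  rewrite /phi !linear_sum summxE; apply: eq_bigr => b _.
  by rewrite !linearZ !mxE mulrC.
exists P; last by move=> i; rewrite -phiX phiP.
(* [P] is injective: if [P v = 0], applying [phi (delta_mx k0 k)] gives [v_k] times column [k0] of
   [P], and that column is the nonzero vector chosen through [j]. *)
rewrite -unitmx_tr -row_free_unit; apply: inj_row_free => v.
move=> /(congr1 trmx); rewrite trmx_mul trmxK trmx0 => Pv0.
apply/eqP; apply: contraNT colj => v0.
have [k vk0] : exists k, v 0 k != 0.
  apply/existsP; apply: contraNT v0 => /existsPn v0.
  by apply/eqP/rowP => k; rewrite mxE; apply/eqP/negPn/v0.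
have := congr1 (mulmx (phi (delta_mx k0 k))) Pv0.
rewrite mulmxA phiP mulmx0 -mulmxA.
have -> : delta_mx k0 k *m v^T = v 0 k *: delta_mx k0 0.
  apply/matrixP => a b; rewrite !mxE (bigD1 k) //= big1 ?addr0.
    by rewrite !mxE ord1 eqxx andbT mulrC.
  by move=> b' nb'; rewrite !mxE (negPf nb') andbF mul0r.
rewrite -scalemxAr -colE => /eqP; rewrite scaler_eq0 (negPf vk0) /= => /eqP/colP Pk0.
by apply/eqP/colP => i; have := Pk0 i; rewrite !mxE.
Qed.

Section Burnside.
Variables (G : groupType) (d : nat).

(** Evaluation at [v] maps [U] onto an invariant subspace, which contains [v] because [1%:M] lies in
    [U]; irreducibility makes it everything. *)
Lemma irreducible_transitive (L : fieldType) (rho : representation G d L)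
    (U : {vspace 'M[L]_d}) :
  irreducible rho -> 1%:M \in U ->
  (forall g A, A \in U -> rho g *m A \in U) ->
  forall v w : 'cV[L]_d, v != 0 -> exists2 A, A \in U & A *m v = w.
Proof.
move=> [_ _ irr] U1 UM v w v0.
pose ev : {linear 'M[L]_d -> 'cV[L]_d} := mulmxr v.
have evE A : linfun ev A = A *m v by rewrite lfunE.
have inv : invariant_sub rho (linfun ev @: U)%VS.
  move=> g _ /memv_imgP[A UA ->]; apply/memv_imgP.
  by exists (rho g *m A); rewrite ?UM // !evE mulmxA.
have v_in : v \in (linfun ev @: U)%VS.
  by apply/memv_imgP; exists 1%:M; rewrite // evE mul1mx.
case: (irr _ inv (subvf _)) => imU.
  by move: v_in; rewrite imU memv0 (negPf v0).
have : w \in (linfun ev @: U)%VS by rewrite imU memvf.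
by move=> /memv_imgP[A UA ->]; exists A.
Qed.

Lemma closed_field_eigenvalue (L : closedFieldType) r (M : 'M[L]_r.+1) :
  exists a, eigenvalue M a.
Proof.
have : size (char_poly M) != 1 by rewrite size_char_poly.
move=> /closed_rootP[a ra]; exists a.
by rewrite eigenvalue_root_char.
Qed.

(** The span of the image is an algebra acting transitively on nonzero vectors. Its nonzero elements
    of least rank have rank one, and transitivity on columns and on rows turns one of them into
    every elementary matrix. *)
Lemma burnside (L : closedFieldType) (rho : representation G d L) :
  irreducible rho ->
  exists gs : 'I_(d * d) -> G, fam_mx (rho \o gs) \in unitmx.
Proof.
move=> irr.
pose A_ s : {vspace 'M[L]_d} := <<map rho s>>%VS.
(* A finite list whose span has maximal dimension already spans all of [rho]. *)
have [s smax] : exists s, forall h, rho h \in A_ s.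
  pose Q (k : nat) := `[< exists s, \dim (A_ s) = k >].
  have exQ : exists k, Q k by exists (\dim (A_ [::])); apply/asboolP; exists [::].
  have bQ k : Q k -> (k <= \dim (fullv : {vspace 'M[L]_d}))%N.
    by move/asboolP => [s <-]; apply/dimvS/subvf.
  case: (ex_maxnP exQ bQ) => k /asboolP[s ks] kmax.
  exists s => h.
  have sub : (A_ s <= A_ (h :: s))%VS.
    by apply: sub_span => x xs; rewrite inE xs orbT.
  have : (A_ s == A_ (h :: s))%VS.
    rewrite eqEdim sub ks; apply: kmax; apply/asboolP.
    by exists (h :: s).
  by move/eqP ->; apply: memv_span; rewrite inE eqxx.
set U := A_ s in smax.
have U1 : 1%:M \in U by rewrite -(repr_mx1 rho) smax.
have lincU A : A \in U -> exists a : 'I_(size s) -> L,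
    A = \sum_i a i *: rho (nth 1%g s i).
  rewrite /U /A_ -[map rho s]/(tval (map_tuple rho (in_tuple s))) => UA.
  exists (fun i => coord (map_tuple rho (in_tuple s)) i A).
  rewrite {1}(coord_span UA); apply: eq_bigr => i _; congr (_ *: _).
  by rewrite (nth_map 1%g) // size_map.
have UM A B : A \in U -> B \in U -> A *m B \in U.
  move=> /lincU[a ->] /lincU[b ->]; rewrite mulmx_suml; apply: memv_suml => i _.
  rewrite -scalemxAl; apply: memvZ; rewrite mulmx_sumr; apply: memv_suml => j _.
  by rewrite -scalemxAr -repr_mxM; apply: memvZ.
have trans := irreducible_transitive irr U1 (fun g A UA => UM _ _ (smax g) UA).
have d_gt0 : (0 < d)%N.
  case: irr => _ full0 _; rewrite lt0n; apply/eqP => d0; apply: full0.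
  apply/eqP; rewrite -dimv_eq0 dimvf /dim /= d0; by [].
pose Q (r : nat) := `[< exists A, [/\ A \in U, A != 0 & \rank A = r] >].
have exQ : exists r, Q r.
  exists (\rank (1%:M : 'M[L]_d)); apply/asboolP; exists 1%:M; split=> //.
  by rewrite -mxrank_eq0 mxrank1 -lt0n.
case: (ex_minnP exQ) => r /asboolP[T [UT T0 rT]] rmin.
(* If the rank is at least 2, write [T = C B] and choose [A] so that [M = B A C] sends the first
   basis vector to the last. For an eigenvalue [a] of [M], the element [T A T - a T = C (M - a) B]
   has smaller rank, hence is zero, and [M] would be scalar. *)
have rank1 : r = 1%N.
  case: r rT rmin => [|[|r]] rT rmin //.
    by move/eqP: rT; rewrite mxrank_eq0 (negPf T0).
  have [C [B [TE fC fB]]] : exists (C : 'M_(d, r.+2)) (B : 'M_(r.+2, d)),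
      [/\ T = C *m B, row_free C^T & row_free B].
    have := mulmx_base T; have := col_base_full T; have := row_base_free T.
    move: (col_base T) (row_base T); rewrite rT => C B fB fC <-.
    by exists C, B; rewrite /row_free mxrank_tr.
  have {}fC : exists C', C' *m C = 1%:M.
    by case/row_freeP: fC => C' /(congr1 trmx); rewrite trmx_mul trmxK trmx1; exists C'^T.
  case: fC fB => C' C'C /row_freeP[B' BB'].
  have Cneq0 : C *m delta_mx ord0 (0 : 'I_1) != 0.
    apply/eqP => /(congr1 (mulmx C')); rewrite mulmxA C'C mul1mx mulmx0.
    by move/matrixP/(_ 0 0); rewrite !mxE !eqxx => /eqP; rewrite oner_eq0.
  have [A UA AC] := trans _ (B' *m delta_mx ord_max 0) Cneq0.
  pose M := B *m A *m C.
  have [a ev_a] := closed_field_eigenvalue M.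
  have UT' : T *m A *m T - a *: T \in U.
    by rewrite memvB ?memvZ // !UM.
  have TE' : T *m A *m T - a *: T = C *m (M - a%:M) *m B.
    rewrite mulmxBr mulmxBl TE /M !mulmxA; congr (_ - _).
    by rewrite mul_mx_scalar -scalemxAl.
  have rk_small : (\rank (T *m A *m T - a *: T)%R < r.+2)%N.
    rewrite TE'; apply: (leq_ltn_trans (mxrankM_maxl _ _)).
    apply: (leq_ltn_trans (mxrankM_maxr _ _)).
    rewrite ltn_neqAle rank_leq_row andbT; apply: contraL ev_a => fM.
    rewrite /eigenvalue /eigenspace negbK; apply/eqP.
    by apply/eqP; rewrite kermx_eq0.
  have T'0 : C *m (M - a%:M) *m B = 0.
    apply/eqP; apply: contraLR rk_small; rewrite -TE' => T'0.
    by rewrite -leqNgt; apply: rmin; apply/asboolP; exists (T *m A *m T - a *: T).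
  have /(congr1 (mulmx C')) := T'0.
  rewrite mulmx0 !mulmxA C'C mul1mx => /(congr1 (mulmx^~ B')).
  rewrite mul0mx -mulmxA BB' mulmx1 => /matrixP/(_ ord_max ord0).
  have -> : (M - a%:M) ord_max ord0 = (M *m delta_mx ord0 (0 : 'I_1)) ord_max 0.
    by rewrite -colE !mxE mulr0n subr0.
  rewrite /M -mulmxA -mulmxA AC mulmxA BB' mul1mx !mxE !eqxx => /eqP.
  by rewrite oner_eq0.
have [C [B TE]] : exists (C : 'cV[L]_d) (B : 'rV[L]_d), T = C *m B.
  have := mulmx_base T; move: (col_base T) (row_base T).
  by rewrite rT rank1 => C B <-; exists C, B.
have C0 : C != 0 by apply: contraNneq T0 => C0; rewrite TE C0 mul0mx.
have B0 : B != 0 by apply: contraNneq T0 => B0; rewrite TE B0 mulmx0.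
pose MB := \matrix_(i < size s) (B *m rho (nth 1%g s i)).
(* Transitivity on rows: a nonzero vector killed by every [B rho(g)] could be moved by [U] onto each
   basis vector, forcing [B = 0]. *)
have rowB y : exists2 A, A \in U & B *m A = y.
  have fB : row_full MB.
    have : row_free MB^T; last by rewrite /row_free mxrank_tr.
    apply: inj_row_free => v /(congr1 trmx); rewrite trmx_mul trmxK trmx0 => Bv.
    apply/eqP; apply: contraNT B0 => v0.
    have vT0 : v^T != 0.
      by apply: contraNneq v0 => /(congr1 trmx); rewrite trmxK trmx0 => ->.
    apply/eqP/rowP => j; have [A UA Av] := trans _ (delta_mx j 0) vT0.
    have : B *m A *m v^T = 0.
      have [a ->] := lincU _ UA; rewrite mulmx_sumr mulmx_suml big1 // => i _.
      rewrite -scalemxAr -scalemxAl.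
      have /(congr1 (row i)) := Bv; rewrite row_mul rowK row0 => ->.
      by rewrite scaler0.
    rewrite -mulmxA Av -colE => /matrixP/(_ 0 0); by rewrite !mxE.
  have /row_fullP[Z ZB] := fB.
  exists (\sum_i (y *m Z) 0 i *: rho (nth 1%g s i)).
    by apply: memv_suml => i _; apply: memvZ.
  rewrite mulmx_sumr -[RHS]mulmx1 -ZB mulmxA [RHS]mulmx_sum_row.
  by apply: eq_bigr => i _; rewrite -scalemxAr rowK.
have Ufull A : A \in U.
  rewrite [A]matrix_sum_delta; apply: memv_suml => i _; apply: memv_suml => j _.
  apply: memvZ.
  have [A1 UA1 A1C] := trans _ (delta_mx i 0) C0.
  have [A2 UA2 A2B] := rowB (delta_mx 0 j).
  have -> : delta_mx i j = A1 *m T *m A2.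
    by rewrite TE mulmxA A1C -mulmxA A2B mul_delta_mx.
  by rewrite !UM.
pose M := \matrix_(i < size s) mxvec (rho (nth 1%g s i)).
have fM : row_full M.
  rewrite -sub1mx; apply/row_subP => k.
  have [a aE] := lincU _ (Ufull (vec_mx (row k 1%:M))).
  rewrite -[row k _]vec_mxK aE linear_sum; apply: summx_sub => i _.
  rewrite linearZ scalemx_sub //=.
  suff -> : mxvec (rho (nth 1%g s i)) = row i M by apply: row_sub.
  by rewrite rowK.
exists (fun i => nth 1%g s (fullrankfun fM i)).
have := fullrowsub_unit fM; congr (_ \in unitmx).
by apply/row_matrixP => i; rewrite row_rowsub !rowK.
Qed.

(** An invariant subspace is stable under all matrices, and a suitable rank-one matrix sends a given
    nonzero vector to any other vector. *)
Lemma fam_mx_irreducible (F : fieldType) (rho : representation G d F)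
    (gs : 'I_(d * d) -> G) :
  (0 < d)%N -> fam_mx (rho \o gs) \in unitmx -> irreducible rho.
Proof.
move=> d_gt0 urho; split.
- by move=> g v _; apply: memvf.
- by move/eqP; rewrite -dimv_eq0 dimvf /dim /= muln1 -leqn0 leqNgt d_gt0.
move=> V invV _; have [->|V0] := eqVneq V 0%VS; [by left | right].
have VM A v : v \in V -> A *m v \in V.
  move=> Vv; rewrite -(coordsK urho A) mulmx_suml; apply: memv_suml => k _.
  by rewrite -scalemxAl memvZ //; apply: invV.
pose v := vpick V; have Vv : v \in V := memv_pick V.
have /existsP[k vk0] : [exists k, v k 0 != 0].
  rewrite -vpick0 in V0; apply: contraNT V0 => /existsPn v0.
  by apply/eqP/colP => k; rewrite mxE; apply/eqP/negPn/v0.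
apply/vspaceP => w; rewrite memvf.
suff -> : w = (w *m delta_mx 0 k) *m ((v k 0)^-1 *: v) by rewrite VM ?memvZ.
rewrite -mulmxA -rowE; apply/colP => i; rewrite !mxE big_ord1 !mxE.
by rewrite mulVf ?mulr1.
Qed.

(** Being a basis of the matrix algebra is the vanishing of no determinant but a nonvanishing one,
    so it survives every field extension. *)
Lemma fam_mx_absolutely_irreducible (F : fieldType) (rho : representation G d F)
    (gs : 'I_(d * d) -> G) :
  (0 < d)%N -> fam_mx (rho \o gs) \in unitmx -> absolutely_irreducible rho.
Proof.
move=> d_gt0 urho E f; apply: (@fam_mx_irreducible _ _ gs) => //.
suff -> : fam_mx (extend_scalars f rho \o gs) = map_mx f (fam_mx (rho \o gs)).
  by rewrite map_unitmx.
by apply/row_matrixP => i; rewrite -map_row !rowK map_mxvec.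
Qed.

End Burnside.

(** * Coordinates determined by traces *)

Lemma map_lincomb (F E : fieldType) (f : {rmorphism F -> E}) n d
    (X : 'I_n -> 'M[F]_d) x :
  map_mx f (lincomb X x) = lincomb (fun k => map_mx f (X k)) (map_mx f x).
Proof.
rewrite /lincomb raddf_sum; apply: eq_bigr => k _ /=.
by rewrite map_mxZ mxE.
Qed.

Lemma map_mulc (F E : fieldType) (f : {rmorphism F -> E}) n
    (c : 'I_n -> 'I_n -> 'rV[F]_n) x y :
  map_mx f (mulc c x y)
  = mulc (fun i j => map_mx f (c i j)) (map_mx f x) (map_mx f y).
Proof.
rewrite /mulc raddf_sum; apply: eq_bigr => i _; rewrite raddf_sum.
by apply: eq_bigr => j _ /=; rewrite map_mxZ !mxE rmorphM.
Qed.

Lemma mxvec_dot_tr (F : fieldType) d (A B : 'M[F]_d) :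
  mxvec A *m (mxvec B^T)^T = (\tr (A *m B))%:M.
Proof.
apply/matrixP => i j; rewrite !ord1 !mxE mulr1n.
rewrite (reindex _ (curry_mxvec_bij _ _)) /= /mxtrace.
under [RHS]eq_bigr do rewrite mxE.
rewrite pair_bigA /=; apply: eq_bigr => [[a b]] _ /=.
by rewrite !mxE !mxvecE mxE.
Qed.

Section TraceCoordinates.
Variables (K : fieldType) (G : groupType) (d : nat) (gs : 'I_(d * d) -> G).
Implicit Types (T : G -> K) (g h : G).

Definition gram T : 'M[K]_(d * d) := \matrix_(i, j) T (gs i * gs j)%g.

(** Solution of the linear system obtained by expanding [g] in the family [gs] and taking traces
    against each [gs j]; only values of [T] enter, so the coordinates stay in [K]. *)
Definition trco T g : 'rV[K]_(d * d) :=
  (\row_j T (g * gs j)%g) *m invmx (gram T).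

Definition trsc T i j := trco T (gs i * gs j)%g.

(** The Casimir element of the trace form divided by [d]: the coefficients of a separability
    idempotent in the basis [e_i] tensor [e_j]. *)
Definition sepW T : 'M[K]_(d * d) := d%:R^-1 *: invmx (gram T).

Lemma trco_gs T i : gram T \in unitmx -> trco T (gs i) = delta_mx 0 i.
Proof.
move=> uT; rewrite /trco.
have -> : \row_j T (gs i * gs j)%g = delta_mx 0 i *m gram T.
  by rewrite -rowE; apply/rowP => j; rewrite !mxE.
by rewrite mulmxK.
Qed.

Variables (E : fieldType) (iota : {rmorphism K -> E}).
Variables (sigma : representation G d E) (T : G -> K).
Hypothesis trT : forall g, \tr (sigma g) = iota (T g).

Let S := fam_mx (sigma \o gs).
Let S' := S *m lin_mx trmx.

Let rowS' j : row j S' = mxvec (sigma (gs j))^T.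
Proof. by rewrite row_mul rowK mul_vec_lin. Qed.

Lemma trace_central g h : T (g * h)%g = T (h * g)%g.
Proof. by apply: (fmorph_inj iota); rewrite -!trT !repr_mxM mxtrace_mulC. Qed.

Let sigmaS' g : mxvec (sigma g) *m S'^T = map_mx iota (\row_j T (g * gs j)%g).
Proof.
apply/rowP => j; have := mxvec_dot_tr (sigma g) (sigma (gs j)).
rewrite -rowS' -repr_mxM trT => /matrixP/(_ 0 0); rewrite !mxE mulr1n => <-.
by apply: eq_bigr => k _; rewrite !mxE.
Qed.

Let gramE : map_mx iota (gram T) = S *m S'^T.
Proof.
apply/row_matrixP => i; rewrite row_mul rowK sigmaS'.
by apply/rowP => j; rewrite !mxE.
Qed.

(** The Gram matrix factors as [S *m S'^T], and [S'] is [S] followed by transposition, which is an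
    involution. *)
Lemma gram_unit : (gram T \in unitmx) = (S \in unitmx).
Proof.
rewrite -(map_unitmx iota) gramE unitmx_mul unitmx_tr /S' unitmx_mul.
suff -> : lin_mx trmx \in @unitmx E (d * d) by rewrite andbT andbb.
suff /mulmx1_unit[] : lin_mx trmx *m lin_mx trmx = 1%:M :> 'M[E]_(d * d) by [].
apply/row_matrixP => k; rewrite rowE mulmxA -[delta_mx _ _]vec_mxK.
by rewrite !mul_vec_lin /= trmxK vec_mxK row1.
Qed.

Hypothesis uT : gram T \in unitmx.

Let uS : S \in unitmx. Proof. by rewrite -gram_unit. Qed.
Let uS' : S'^T \in unitmx.
Proof. by move: uT; rewrite -(map_unitmx iota) gramE unitmx_mul => /andP[]. Qed.

Lemma sigma_trco g :
  sigma g = lincomb (sigma \o gs) (map_mx iota (trco T g)).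
Proof.
apply: (can_inj mxvecK); rewrite mxvec_lincomb -/S map_mxM map_invmx gramE.
rewrite -sigmaS' -{2}(mulmxKV uS (mxvec (sigma g))) -!mulmxA (mulmxA S) mulmxA.
rewrite [X in _ = _ *m X]mulmxA mulmxV ?mul1mx ?mulmxKV //.
by rewrite unitmx_mul uS uS'.
Qed.

Lemma sigma_trsc i j :
  sigma (gs i) *m sigma (gs j)
  = lincomb (sigma \o gs) (map_mx iota (trsc T i j)).
Proof. by rewrite -repr_mxM -sigma_trco. Qed.

(** Lets identities between coordinates over [K] be checked on matrices over [E], where they follow
    from the matrix product. *)
Lemma lincomb_map_inj :
  injective (fun x => lincomb (sigma \o gs) (map_mx iota x)).
Proof.
by move=> x y /(fam_mx_inj uS); apply: map_mx_inj; apply: fmorph_inj.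
Qed.

Lemma trcoM g h : trco T (g * h)%g = mulc (trsc T) (trco T g) (trco T h).
Proof.
apply: lincomb_map_inj; rewrite /= -sigma_trco map_mulc.
by rewrite (lincombM _ _ sigma_trsc) -!sigma_trco repr_mxM.
Qed.

Lemma trsc_assoc a b c :
  \sum_l trsc T a b 0 l *: trsc T l c = \sum_l trsc T b c 0 l *: trsc T a l.
Proof.
apply: lincomb_map_inj => /=; rewrite !raddf_sum /=.
transitivity (sigma (gs a) *m sigma (gs b) *m sigma (gs c)).
  rewrite sigma_trsc mulmx_suml; apply: eq_bigr => l _.
  by rewrite map_mxZ linearZ /= -sigma_trsc -scalemxAl [in RHS]mxE.
rewrite -mulmxA sigma_trsc mulmx_sumr; apply: eq_bigr => l _.
by rewrite -scalemxAr map_mxZ linearZ /= -sigma_trsc [in LHS]mxE.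
Qed.

(** Centrality of the Casimir element: multiplying its first leg by [a] on the left equals
    multiplying its second leg by [a] on the right. In matrix form this is the cyclic invariance of
    [T]. *)
Lemma sepW_trsc k l a :
  \sum_i sepW T i l * trsc T a i 0 k = \sum_j sepW T k j * trsc T j a 0 l.
Proof.
pose La : 'M[K]_(d * d) := \matrix_i trsc T a i.
pose Ra : 'M[K]_(d * d) := \matrix_j trsc T j a.
have gramT : (gram T)^T = gram T.
  by apply/matrixP => i j; rewrite !mxE trace_central.
have LaE : La = (\matrix_(i, j) T (gs a * gs i * gs j)%g) *m invmx (gram T).
  by apply/row_matrixP => i; rewrite row_mul rowK; congr (_ *m _); apply/rowP => j; rewrite !mxE.
have RaE : Ra = (\matrix_(i, j) T (gs i * gs a * gs j)%g) *m invmx (gram T).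
  by apply/row_matrixP => i; rewrite row_mul rowK; congr (_ *m _); apply/rowP => j; rewrite !mxE.
have : La^T *m sepW T = sepW T *m Ra.
  rewrite LaE RaE trmx_mul trmx_inv gramT /sepW -scalemxAr -scalemxAl mulmxA.
  congr (_ *: (_ *m _ *m _)); apply/matrixP => i j; rewrite !mxE.
  by rewrite trace_central mulgA.
move/matrixP/(_ k l); rewrite !mxE => LR.
transitivity (\sum_j La^T k j * sepW T j l).
  by apply: eq_bigr => i _; rewrite !mxE mulrC.
by rewrite LR; apply: eq_bigr => i _; rewrite !mxE.
Qed.

(** The two legs of the separability idempotent multiply to 1. The Casimir element itself multiplies
    to [d], which is why [d] must be invertible. *)
Lemma sepW_unit i0 : gs i0 = 1%g -> d%:R != 0 :> K ->
  \sum_i \sum_j sepW T i j *: trsc T i j = delta_mx 0 i0.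
Proof.
move=> gs0 d0; apply: lincomb_map_inj => /=.
rewrite map_delta_mx lincomb_delta /= gs0 repr_mx1 raddf_sum linear_sum /=.
pose I := invmx (map_mx iota (gram T)).
(* Entrywise form of [S'^T *m I *m S = 1]: the inverse Gram matrix pairs the basis with its dual for
   the trace form. Summing over [x] below produces the factor [d]. *)
have dual x y e : \sum_i \sum_j I i j * (sigma (gs i) y x * sigma (gs j) x e)
    = (y == e)%:R.
  have : S'^T *m I *m S = 1%:M.
    rewrite /I gramE; apply: (can_inj (mulmxK uS')).
    by rewrite mul1mx -!mulmxA mulVmx ?mulmx1 // unitmx_mul uS uS'.
  move=> /(congr1 (row (mxvec_index x y))); rewrite row1 -mxvec_delta.
  move=> /matrixP/(_ 0 (mxvec_index x e)); rewrite mxvecE !mxE eqxx /= eq_sym => <-.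
  rewrite exchange_big /=; apply: eq_bigr => j _.
  rewrite !mxE mulr_suml; apply: eq_bigr => i _.
  have -> : S'^T (mxvec_index x y) i = row i S' 0 (mxvec_index x y) by rewrite !mxE.
  by rewrite rowS' !mxvecE mxE /= mulrA; congr (_ * _); rewrite mulrC.
apply/matrixP => y e; rewrite [RHS]mxE summxE.
transitivity (iota d%:R^-1 * \sum_i \sum_j I i j * (sigma (gs i) *m sigma (gs j)) y e).
  rewrite mulr_sumr; apply: eq_bigr => i _; rewrite raddf_sum linear_sum summxE mulr_sumr.
  apply: eq_bigr => j _ /=; rewrite map_mxZ linearZ /= -sigma_trsc mxE [sepW T i j]mxE rmorphM.
  by rewrite /I -map_invmx [X in _ = _ * (X * _)]mxE mulrA.
have -> : \sum_i \sum_j I i j * (sigma (gs i) *m sigma (gs j)) y e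
    = \sum_(x < d) (y == e)%:R.
  under eq_bigr => i _ do under eq_bigr => j _ do rewrite mxE mulr_sumr.
  under eq_bigr => i _ do rewrite exchange_big /=.
  by rewrite exchange_big /=; apply: eq_bigr => x _; rewrite dual.
rewrite sumr_const card_ord -[X in _ * X]mulr_natl fmorphV rmorph_nat mulKf //.
by rewrite -(rmorph_nat iota) fmorph_eq0.
Qed.

End TraceCoordinates.

(** * Absolute values and uniform limits *)

Section AbsoluteValue.
Variables (R : realType) (K : completeValuedFieldType R).
Implicit Types x y : K.

Lemma absv0 : absv (0 : K) = 0.
Proof. by apply/absv_eq0. Qed.

Lemma absv_neq0 x : x != 0 -> absv x != 0.
Proof. by apply: contra_neq => /absv_eq0. Qed.

Lemma absv_gt0 x : x != 0 -> 0 < absv x.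
Proof. by move=> x0; rewrite lt0r absv_neq0 // absv_ge0. Qed.

Lemma absv1 : absv (1 : K) = 1.
Proof.
apply: (mulfI (absv_neq0 (oner_neq0 K))).
by rewrite -absvM !mulr1.
Qed.

Lemma absvN x : absv (- x) = absv x.
Proof.
rewrite -mulN1r absvM; suff -> : absv (-1 : K) = 1 by rewrite mul1r.
apply/eqP; rewrite -(eqrXn2 (_ : 0 < 2)%N) ?absv_ge0 ?ler01 //.
by rewrite expr1n expr2 -absvM mulrNN mulr1 absv1.
Qed.

Lemma absvBC x y : absv (x - y) = absv (y - x).
Proof. by rewrite -opprB absvN. Qed.

Lemma absvV x : x != 0 -> absv x^-1 = (absv x)^-1.
Proof.
move=> x0; apply: (mulfI (absv_neq0 x0)).
by rewrite -absvM !divff ?absv1 // absv_neq0.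
Qed.

Lemma ler_absv_sum (I : Type) (r : seq I) (P : pred I) (F : I -> K) :
  absv (\sum_(i <- r | P i) F i) <= \sum_(i <- r | P i) absv (F i).
Proof.
elim/big_ind2: _ => [|x a y b xa yb|//]; first by rewrite absv0.
by apply: (le_trans (ler_absvD _ _)); apply: lerD.
Qed.

End AbsoluteValue.

Section UniformLimits.
Variables (R : realType) (K : completeValuedFieldType R).

Lemma cvg_absvP (u : nat -> K) (l : K) :
  u @ \oo --> l <->
  (forall e : R, 0 < e -> \forall n \near \oo, absv (u n - l) < e).
Proof.
split=> [/cvg_ballP ul e e0|ul].
  by near=> n; rewrite absvBC; apply/ball_absvE; near: n; apply: ul.
apply/cvg_ballP => e e0; near=> n.
by apply/ball_absvE; rewrite absvBC; near: n; apply: ul.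
Unshelve. all: by end_near. Qed.

Lemma uniform_absvP (U : choiceType) (F : nat -> U -> K) (f : U -> K) :
  {uniform, F @ \oo --> f} <->
  (forall e : R, 0 < e -> \forall n \near \oo, forall x, absv (F n x - f x) < e).
Proof.
split=> [Ff e e0|Ff].
  have /Ff : nbhs (f : {uniform U -> K})
      [set h | forall x, absv (h x - f x) < e].
    apply/uniform_nbhs; exists [set xy | ball xy.1 e xy.2]; split.
      by rewrite -entourage_ballE; exists e.
    by move=> h /= fh x; rewrite absvBC; apply/ball_absvE/fh.
  by [].
move=> P /uniform_nbhs[E [entE EP]].
move: entE; rewrite -entourage_ballE => -[e /= e0 eE].
rewrite nbhs_filterE; apply: filterS (Ff e e0) => n Fn; apply: EP => x _.
by apply: eE => /=; apply/ball_absvE; rewrite absvBC.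
Qed.

Section Calculus.
Variable I : Type.
Implicit Types (F G : nat -> I -> K) (f g : I -> K).

Definition ubounded f := exists B : R, forall i, absv (f i) <= B.

(** Boundedness of the limit is included so that products preserve uniform convergence. With [I]
    equal to [unit] this is ordinary convergence, so one calculus serves both the pointwise and the
    uniform claims. *)
Definition ucvg F f := ubounded f /\
  forall e : R, 0 < e -> \forall n \near \oo, forall i, absv (F n i - f i) < e.

Lemma ubounded_cst (a : K) : ubounded (fun=> a).
Proof. by exists (absv a). Qed.

Lemma ucvg_cst f : ubounded f -> ucvg (fun=> f) f.
Proof. by move=> bf; split=> // e e0; apply: nearW => n i; rewrite subrr absv0. Qed.

Lemma ucvg_near F F' f :
  (\forall n \near \oo, forall i, F n i = F' n i) -> ucvg F f -> ucvg F' f.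
Proof.
move=> FF' [bf Ff]; split=> // e e0.
by apply: filterS2 FF' (Ff e e0) => n FFn Fn i; rewrite -FFn.
Qed.

Lemma ucvgD F G f g : ucvg F f -> ucvg G g ->
  ucvg (fun n i => F n i + G n i) (fun i => f i + g i).
Proof.
move=> [[Bf bf] Ff] [[Bg bg] Gg]; split.
  by exists (Bf + Bg) => i; rewrite (le_trans (ler_absvD _ _)) ?lerD.
move=> e e0; have e2 : 0 < e / 2 by rewrite divr_gt0.
apply: filterS2 (Ff _ e2) (Gg _ e2) => n Fn Gn i.
rewrite opprD addrACA (le_lt_trans (ler_absvD _ _)) //.
by rewrite [e]splitr ltrD.
Qed.

Lemma ucvgM F G f g : ucvg F f -> ucvg G g ->
  ucvg (fun n i => F n i * G n i) (fun i => f i * g i).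
Proof.
move=> [[Bf bf] Ff] [[Bg bg] Gg].
have {}bf i : absv (f i) <= `|Bf| by rewrite (le_trans (bf i)) ?ler_norm.
have {}bg i : absv (g i) <= `|Bg| by rewrite (le_trans (bg i)) ?ler_norm.
split; first by exists (`|Bf| * `|Bg|) => i; rewrite absvM ler_pM ?absv_ge0.
(* The error of a product is split into a quadratic term and two linear ones. The bound 1 controls
   one factor of the quadratic term, and [e / b] makes the three terms sum to [e]. *)
move=> e e0; pose b := 1 + `|Bg| + `|Bf|.
have b0 : 0 < b by rewrite !ltr_pwDl.
have t0 : 0 < Num.min 1 (e / b) by rewrite lt_min ltr01 divr_gt0.
apply: filterS2 (Ff _ t0) (Gg _ t0) => n Fn Gn i.
move: (Fn i) (Gn i); rewrite !lt_min => /andP[F1 Fe] /andP[G1 Ge].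
have -> : F n i * G n i - f i * g i = (F n i - f i) * (G n i - g i)
    + (F n i - f i) * g i + f i * (G n i - g i).
  by rewrite -mulrDr subrK !mulrBl mulrBr addrA subrK.
have -> : e = (e / b) * 1 + (e / b) * `|Bg| + `|Bf| * (e / b).
  by rewrite [X in _ + X]mulrC -!mulrDr divfK ?gt_eqF.
rewrite (le_lt_trans (ler_absvD _ _)) // ltr_leD //; last first.
  by rewrite absvM ler_pM ?absv_ge0 // ltW.
rewrite (le_lt_trans (ler_absvD _ _)) // ltr_leD //; last first.
  by rewrite absvM ler_pM ?absv_ge0 // ltW.
by rewrite absvM ltr_pM ?absv_ge0.
Qed.

Lemma ucvg_ext F F' f f' : (forall n i, F n i = F' n i) ->
  (forall i, f i = f' i) -> ucvg F f -> ucvg F' f'.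
Proof.
move=> /funeq2P <- /funext <-; exact.
Qed.

Lemma ucvg_sum (J : Type) (r : seq J) (F : J -> nat -> I -> K) (f : J -> I -> K) :
  (forall j, ucvg (F j) (f j)) ->
  ucvg (fun n i => \sum_(j <- r) F j n i) (fun i => \sum_(j <- r) f j i).
Proof.
move=> Ff; elim: r => [|j r IH].
  by apply: ucvg_ext (ucvg_cst (ubounded_cst 0)) => *; rewrite big_nil.
by apply: ucvg_ext (ucvgD (Ff j) IH) => *; rewrite big_cons.
Qed.

Lemma ucvg_prod (J : Type) (r : seq J) (F : J -> nat -> I -> K) (f : J -> I -> K) :
  (forall j, ucvg (F j) (f j)) ->
  ucvg (fun n i => \prod_(j <- r) F j n i) (fun i => \prod_(j <- r) f j i).
Proof.
move=> Ff; elim: r => [|j r IH].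
  by apply: ucvg_ext (ucvg_cst (ubounded_cst 1)) => *; rewrite big_nil.
by apply: ucvg_ext (ucvgM (Ff j) IH) => *; rewrite big_cons.
Qed.

Lemma ucvgV_cst (u : nat -> K) (l : K) : l != 0 ->
  ucvg (fun n (_ : I) => u n) (fun=> l) ->
  ucvg (fun n (_ : I) => (u n)^-1) (fun=> l^-1).
Proof.
move=> l0 [_ ul]; split; first exact: ubounded_cst.
move=> e e0; have al := absv_gt0 l0.
have l2 : 0 < absv l / 2 by rewrite divr_gt0.
(* The difference of inverses is [(l - u n) / (u n * l)], whose denominator exceeds
   [absv l / 2 * absv l] in absolute value. *)
have t0 : 0 < e * (absv l / 2 * absv l) by rewrite mulr_gt0 // mulr_gt0.
apply: filterS2 (ul _ l2) (ul _ t0) => n un1 un2 i.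
have {}un1 : absv l / 2 < absv (u n).
  have : absv l <= absv (u n) + absv (u n - l).
    by rewrite -{1}[l](subKr (u n)) (le_trans (ler_absvD _ _)) // absvN.
  rewrite -lerBlDr; apply: lt_le_trans.
  by rewrite ltrBrDr [ltRHS]splitr ltrD2l; apply: un1.
have un0 : u n != 0.
  by apply: contraTneq un1 => ->; rewrite absv0 -leNgt ltW.
have -> : (u n)^-1 - l^-1 = (l - u n) / (u n * l).
  by field; rewrite un0 l0.
rewrite absvM absvV ?mulf_neq0 // absvM ltr_pdivrMr ?mulr_gt0 ?absv_gt0 //.
rewrite absvBC (lt_trans (un2 i)) // ltr_pM2l // ltr_pM2r //.
Qed.

Lemma ucvg_det m (A : nat -> 'M[K]_m) (A0 : 'M[K]_m) :
  (forall i j, ucvg (fun n (_ : I) => A n i j) (fun=> A0 i j)) ->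
  ucvg (fun n (_ : I) => \det (A n)) (fun=> \det A0).
Proof.
move=> AA0; rewrite /determinant; apply: ucvg_sum => s.
apply: ucvgM; first exact/ucvg_cst/ubounded_cst.
by apply: ucvg_prod => i; apply: AA0.
Qed.

End Calculus.

Lemma ucvg_reindex (I J : Type) (h : J -> I) (F : nat -> I -> K) f :
  ucvg F f -> ucvg (fun n j => F n (h j)) (fun j => f (h j)).
Proof.
move=> [[B bf] Ff]; split; first by exists B => j.
by move=> e /Ff; apply: filterS => n Fn j.
Qed.

Lemma ucvg_unitP (u : nat -> K) (l : K) :
  ucvg (fun n (_ : unit) => u n) (fun=> l) <-> u @ \oo --> l.
Proof.
split=> [[_ ul]|/cvg_absvP ul].
  by apply/cvg_absvP => e /ul; apply: filterS => n; apply; exact: tt.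
split; first exact: ubounded_cst.
by move=> e /ul; apply: filterS.
Qed.

Lemma ucvg_unitmx m (A : nat -> 'M[K]_m) (A0 : 'M[K]_m) :
  (forall i j, ucvg (fun n (_ : unit) => A n i j) (fun=> A0 i j)) ->
  A0 \in unitmx -> \forall n \near \oo, A n \in unitmx.
Proof.
move=> AA0; rewrite unitmxE unitfE => d0.
have [_ /(_ _ (absv_gt0 d0))] := ucvg_det AA0.
apply: filterS => n /(_ tt); rewrite unitmxE unitfE; apply: contraTneq => ->.
by rewrite sub0r absvN ltxx.
Qed.

Lemma ucvg_invmx m (A : nat -> 'M[K]_m) (A0 : 'M[K]_m) :
  (forall i j, ucvg (fun n (_ : unit) => A n i j) (fun=> A0 i j)) ->
  A0 \in unitmx ->
  forall i j, ucvg (fun n (_ : unit) => invmx (A n) i j) (fun=> invmx A0 i j).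
Proof.
move=> AA0 u0 i j.
(* The cofactor formula for [invmx] holds only once [A n] is invertible, hence eventually. *)
apply: (@ucvg_near _ (fun n _ => (\det (A n))^-1 * cofactor (A n) j i)).
  apply: filterS (ucvg_unitmx AA0 u0) => n un _.
  by rewrite /invmx un !mxE.
rewrite /invmx u0 mxE [X in _ * X]mxE; apply: ucvgM.
  by apply/ucvgV_cst/ucvg_det; rewrite // -unitfE -unitmxE.
apply: ucvgM; first exact/ucvg_cst/ubounded_cst.
by apply: ucvg_det => a b; apply: ucvg_ext (AA0 (lift j a) (lift i b)) => *; rewrite !mxE.
Qed.

Lemma geometric_limit (u : nat -> K) (B : R) :
  (forall n, absv (u n.+1 - u n) <= B / 2 ^+ n) ->
  exists l, forall n, absv (l - u n) <= B * 2 / 2 ^+ n.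
Proof.
move=> uB.
have B0 : 0 <= B by have := le_trans (absv_ge0 _) (uB 0); rewrite expr0 divr1.
have uD n k : absv (u (n + k)%N - u n) <= B * 2 / 2 ^+ n.
  (* The factor [1 - 2^-k] records the partial geometric sum and makes the induction go through. *)
  suff : absv (u (n + k)%N - u n) <= B * 2 / 2 ^+ n * (1 - 2^-1 ^+ k).
    move/le_trans; apply; rewrite ler_piMr ?mulr_ge0 ?invr_ge0 ?exprn_ge0 //.
    by rewrite gerBl exprn_ge0 // invr_ge0.
  elim: k => [|k IH]; first by rewrite addn0 subrr absv0 expr0 subrr mulr0.
  rewrite addnS -(subrK (u (n + k)%N) (u _.+1)) -addrA.
  apply: (le_trans (ler_absvD _ _)); apply: (le_trans (lerD (uB _) IH)).
  rewrite exprD exprS exprVn invfM.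
  have := exprn_gt0 n (ltr0n R 2); have := exprn_gt0 k (ltr0n R 2).
  move: (2 ^+ n) (2 ^+ k) => a b b0 a0; rewrite le_eqVlt; apply/orP; left; apply/eqP.
  by field; rewrite !gt_eqF.
have geom e : 0 < e -> exists n, B * 2 / 2 ^+ n < e.
  move=> e0; pose n := Num.bound (B * 2 / e); exists n.
  rewrite ltr_pdivrMr ?exprn_gt0 // -ltr_pdivrMl // mulrC.
  have := archi_boundP (divr_ge0 (mulr_ge0 B0 (ler0n R 2)) (ltW e0)).
  move/lt_trans; apply; rewrite -natrX ltr_nat; exact: ltn_expl.
have : cvg (u @ \oo).
  apply/cauchy_cvgP/cauchy_exP => e e0; have [n ne] := geom e e0.
  exists (u n); exists n => // m /= nm; apply/ball_absvE.
  by rewrite absvBC -(subnKC nm) (le_lt_trans (uD _ _)).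
move=> /cvg_ex[l /cvg_absvP ul]; exists l => n; apply/ler_addgt0Pr => e e0.
have [m _ um] := ul e e0; have := um (n + m)%N (leq_addl _ _).
move=> /= ume; rewrite -(subrK (u (n + m)%N) l) -addrA addrC.
by apply: (le_trans (ler_absvD _ _)); rewrite lerD // absvBC ltW.
Qed.

Lemma ler_geometric0 (x B : R) : (forall n, x <= B / 2 ^+ n) -> x <= 0.
Proof.
move=> xB; rewrite leNgt; apply/negP => x0.
have B0 : 0 <= B by have := le_trans (ltW x0) (xB 0%N); rewrite expr0 divr1.
have := xB (Num.bound (B / x)); rewrite leNgt => /negP; apply.
rewrite ltr_pdivrMr ?exprn_gt0 // -ltr_pdivrMl // mulrC.
apply: (lt_trans (archi_boundP (divr_ge0 B0 (ltW x0)))).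
by rewrite -natrX ltr_nat ltn_expl.
Qed.

End UniformLimits.

(** * Newton iteration towards multiplicative maps *)

Section Newton.
Variables (R : realType) (K : completeValuedFieldType R) (N d : nat).
Variables (c : 'I_N -> 'I_N -> 'rV[K]_N) (W : 'M[K]_N) (i0 : 'I_N).
Hypothesis cA : forall i j k,
  \sum_l c i j 0 l *: c l k = \sum_l c j k 0 l *: c i l.
Hypothesis cunit : forall j, c j i0 = delta_mx 0 j.
Hypothesis W_unit : \sum_i \sum_j W i j *: c i j = delta_mx 0 i0.
Hypothesis W_central : forall k l i,
  \sum_j W j l * c i j 0 k = \sum_j W k j * c j i 0 l.
Implicit Types f : 'I_N -> 'M[K]_d.

Definition defect f i j : 'M[K]_d := lincomb f (c i j) - f i *m f j.

Definition wsum (Z : 'I_N -> 'I_N -> 'M[K]_d) := \sum_i \sum_j W i j *: Z i j.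

(** Contraction of the defect with the separability idempotent [W]: the homotopy by which the
    Hochschild [H^2] of a separable algebra vanishes. *)
Definition correction f k := wsum (fun i j => f i *m defect f j k).

Definition newton f k := f k + correction f k.

Lemma newton_unit f : f i0 = 1%:M -> newton f i0 = 1%:M.
Proof.
move=> f1; rewrite /newton f1 /correction /wsum big1 ?addr0 // => i _.
rewrite big1 // => j _.
by rewrite /defect cunit lincomb_delta f1 mulmx1 subrr mulmx0 scaler0.
Qed.

(** The Hochschild 2-cocycle identity. It is exact although [f] is not multiplicative: associativity
    of [c] identifies the two values of [f] on a triple product, and the other terms cancel. *)
Lemma defect_cocycle f i j k :
  \sum_l c j k 0 l *: defect f i l
  = defect f i j *m f k - f i *m defect f j k
    + \sum_l c i j 0 l *: defect f l k.
Proof.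
have -> : \sum_l c j k 0 l *: defect f i l
    = lincomb f (\sum_l c j k 0 l *: c i l) - f i *m lincomb f (c j k).
  rewrite linear_sum mulmx_sumr -sumrB; apply: eq_bigr => l _.
  by rewrite linearZ scalerBr -scalemxAr.
have -> : \sum_l c i j 0 l *: defect f l k
    = lincomb f (\sum_l c i j 0 l *: c l k) - lincomb f (c i j) *m f k.
  rewrite linear_sum mulmx_suml -sumrB; apply: eq_bigr => l _.
  by rewrite linearZ scalerBr -scalemxAl.
rewrite cA /defect mulmxBl mulmxBr mulmxA.
move: (lincomb f (\sum_l _)) (f i *m lincomb f _) (lincomb f _ *m f k) (f i *m f j *m f k).
by move=> A B C D; apply/matrixP => a b; rewrite !mxE; ring.
Qed.

Lemma wsumD Z Z' : wsum (fun i j => Z i j + Z' i j) = wsum Z + wsum Z'.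
Proof.
rewrite /wsum -big_split; apply: eq_bigr => i _; rewrite -big_split.
by apply: eq_bigr => j _; rewrite scalerDr.
Qed.

Lemma wsumN Z : wsum (fun i j => - Z i j) = - wsum Z.
Proof.
rewrite /wsum -sumrN; apply: eq_bigr => i _; rewrite -sumrN.
by apply: eq_bigr => j _; rewrite scalerN.
Qed.

Lemma wsum_mulr Z A : wsum (fun i j => Z i j *m A) = wsum Z *m A.
Proof.
rewrite /wsum mulmx_suml; apply: eq_bigr => i _; rewrite mulmx_suml.
by apply: eq_bigr => j _; rewrite scalemxAl.
Qed.

Lemma wsum_mull Z A : wsum (fun i j => A *m Z i j) = A *m wsum Z.
Proof.
rewrite /wsum mulmx_sumr; apply: eq_bigr => i _; rewrite mulmx_sumr.
by apply: eq_bigr => j _; rewrite scalemxAr.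
Qed.

Lemma eq_wsum Z Z' : (forall i j, Z i j = Z' i j) -> wsum Z = wsum Z'.
Proof. by move=> ZZ'; apply: eq_bigr => i _; apply: eq_bigr => j _; rewrite ZZ'. Qed.

(* W is a separability idempotent, so the correction kills the part of the
   defect that is linear in the defect. *)
Lemma defect_newton f x y : f i0 = 1%:M ->
  defect (newton f) x y =
    wsum (defect f) *m defect f x y
    + wsum (fun i j => defect f x i *m defect f j y)
    - correction f x *m correction f y.
Proof.
move=> f1; set h := correction f.
(* The coboundary of [h] equals the defect up to terms quadratic in the defect. *)
have hE : lincomb h (c x y) = h x *m f y
    - (defect f x y - wsum (defect f) *m defect f x y)
    + (f x *m h y + wsum (fun i j => defect f x i *m defect f j y)).
  have -> : lincomb h (c x y)
      = wsum (fun i j => f i *m \sum_l c x y 0 l *: defect f j l).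
    rewrite /lincomb /h /correction /wsum.
    under eq_bigr => l _ do rewrite scaler_sumr.
    rewrite exchange_big; apply: eq_bigr => i _.
    under eq_bigr => l _ do rewrite scaler_sumr.
    rewrite exchange_big; apply: eq_bigr => j _ /=.
    rewrite mulmx_sumr scaler_sumr; apply: eq_bigr => l _.
    by rewrite -scalemxAr !scalerA mulrC.
  under eq_wsum => i j do rewrite defect_cocycle mulmxDr mulmxBr !mulmxA.
  rewrite [LHS]wsumD [X in X + _ = _]wsumD wsumN !wsum_mulr; congr (_ - _ + _).
    (* Since the legs of [W] multiply to the unit and [f] preserves the unit, this sum is 1 up to a
       defect. *)
    have -> : wsum (fun i j => f i *m f j) = 1%:M - wsum (defect f).
      rewrite -f1 -[f i0]lincomb_delta -W_unit linear_sum /wsum -sumrB.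
      apply: eq_bigr => i _; rewrite linear_sum -sumrB; apply: eq_bigr => j _.
      by rewrite linearZ /= -scalerBr /defect opprB addrC subrK.
    by rewrite mulmxBl mul1mx.
  rewrite /h /correction -wsum_mull -wsumD.
  under [RHS]eq_wsum => i j do
    rewrite mulmxA -mulmxDl [in X in X *m _]/defect [f x *m f i + _]addrC subrK.
  transitivity (\sum_k \sum_l (\sum_j W k j * c j x 0 l) *: (f k *m defect f l y)).
    apply: eq_bigr => k _; under [RHS]eq_bigr => l _ do rewrite scaler_suml.
    rewrite exchange_big; apply: eq_bigr => j _ /=; rewrite mulmx_sumr scaler_sumr.
    by apply: eq_bigr => l _; rewrite -scalemxAr scalerA.
  (* Centrality of [W] moves [x] from the second leg to the first, where [f (x e_j)] is [f x *m f j]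
     plus a defect. *)
  under eq_bigr => k _ do under eq_bigr => l _ do rewrite -W_central scaler_suml.
  rewrite /wsum exchange_big [RHS]exchange_big; apply: eq_bigr => l _ /=.
  rewrite exchange_big; apply: eq_bigr => j _ /=.
  rewrite mulmx_suml scaler_sumr; apply: eq_bigr => k _.
  by rewrite -scalemxAl scalerA.
have -> : defect (newton f) x y
    = defect f x y + lincomb h (c x y) - h x *m f y - f x *m h y - h x *m h y.
  have -> : defect (newton f) x y = lincomb f (c x y) + lincomb h (c x y)
      - (f x + h x) *m (f y + h y).
    rewrite /defect; congr (_ - _); rewrite /lincomb -big_split.
    by apply: eq_bigr => k _; rewrite scalerDr.
  rewrite mulmxDl !mulmxDr /defect.
  move: (lincomb f _) (lincomb h _) (f x *m f y) (h x *m f y) (f x *m h y) (h x *m h y).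
  by move=> *; apply/matrixP => a b; rewrite !mxE; ring.
rewrite hE.
move: (wsum (defect f) *m _) => A; move: (wsum _) (h x *m f y) (f x *m h y) (h x *m h y).
by move=> *; apply/matrixP => a b; rewrite !mxE; ring.
Qed.

(** An abstract norm, because the norm used later depends on the basis, hence on the index of the
    sequence. Only the constants [M], [w] and [Q] enter the estimates. *)
Variables (nu : 'M[K]_d -> R) (M w Q : R).
Hypothesis nu_ge0 : forall A, 0 <= nu A.
Hypothesis nuD : forall A B, nu (A + B) <= nu A + nu B.
Hypothesis nuZ : forall a A, nu (a *: A) = absv a * nu A.
Hypothesis nuM : forall A B, nu (A *m B) <= M * (nu A * nu B).
Hypothesis nu_eq0 : forall A, nu A <= 0 -> A = 0.
Hypothesis M_ge0 : 0 <= M.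
Hypothesis W_le : \sum_i \sum_j absv (W i j) <= w.
Hypothesis nu_complete : forall (Y : nat -> 'M[K]_d) (B : R),
  (forall n, nu (Y n.+1 - Y n) <= B / 2 ^+ n) ->
  exists Z, forall n, nu (Z - Y n) <= Q * B / 2 ^+ n.

Let nu0 : nu 0 = 0.
Proof. by rewrite -(scale0r 0) nuZ absv0 mul0r. Qed.

Let nuN A : nu (- A) = nu A.
Proof. by rewrite -scaleN1r nuZ absvN absv1 mul1r. Qed.

Let nu_sum (I : Type) (r : seq I) (F : I -> 'M[K]_d) :
  nu (\sum_(i <- r) F i) <= \sum_(i <- r) nu (F i).
Proof.
elim/big_ind2: _ => [|x a y b xa yb|//]; first by rewrite nu0.
by apply: (le_trans (nuD _ _)); apply: lerD.
Qed.

Let w_ge0 : 0 <= w.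
Proof.
apply: le_trans W_le; apply: sumr_ge0 => i _; apply: sumr_ge0 => j _.
exact: absv_ge0.
Qed.

Lemma nu_wsum Z B : 0 <= B -> (forall i j, nu (Z i j) <= B) -> nu (wsum Z) <= w * B.
Proof.
move=> B0 ZB; apply: le_trans (ler_wpM2r B0 W_le).
rewrite mulr_suml; apply: (le_trans (nu_sum _ _)); apply: ler_sum => i _.
rewrite mulr_suml; apply: (le_trans (nu_sum _ _)); apply: ler_sum => j _.
by rewrite nuZ ler_wpM2l ?absv_ge0.
Qed.

Let nuM_le A B a b : nu A <= a -> nu B <= b -> nu (A *m B) <= M * (a * b).
Proof.
move=> Aa Bb; apply: (le_trans (nuM _ _)); apply: ler_wpM2l => //.
by apply: ler_pM.
Qed.

(** For [nu (f i) <= 2] and defect at most [D], the correction is at most [2 w M D]; the three terms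
    of [defect_newton] then add up to this constant times [D ^+ 2]. *)
Definition newton_cst : R := 2 * w * M + 4 * w ^+ 2 * M ^+ 3.

Lemma newton_cst_ge0 : 0 <= newton_cst.
Proof. by rewrite addr_ge0 ?mulr_ge0 ?exprn_ge0. Qed.

Lemma newton_step f D : f i0 = 1%:M ->
  (forall i, nu (f i) <= 2) -> (forall i j, nu (defect f i j) <= D) ->
  (forall k, nu (correction f k) <= newton_cst * D) /\
  (forall i j, nu (defect (newton f) i j) <= newton_cst * D ^+ 2).
Proof.
move=> f1 f2 fD.
have D0 : 0 <= D := le_trans (nu_ge0 _) (fD i0 i0).
have corrD k : nu (correction f k) <= w * (M * (2 * D)).
  by apply: nu_wsum => [|i j]; [rewrite !mulr_ge0 | apply: nuM_le].
split=> [k|x y].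
  apply: (le_trans (corrD k)); rewrite /newton_cst.
  have -> : w * (M * (2 * D)) = 2 * w * M * D by ring.
  by rewrite [leRHS]mulrDl lerDl !mulr_ge0 ?exprn_ge0.
rewrite defect_newton //.
apply: (le_trans (nuD _ _)); rewrite nuN.
have -> : newton_cst * D ^+ 2 = M * (w * D * D) + w * (M * (D * D))
    + M * ((w * (M * (2 * D))) * (w * (M * (2 * D)))).
  by rewrite /newton_cst; ring.
apply: lerD; last exact: nuM_le.
apply: (le_trans (nuD _ _)); apply: lerD; first by apply/nuM_le/fD/nu_wsum.
by apply: nu_wsum => [|i j]; [rewrite !mulr_ge0 | apply: nuM_le].
Qed.

(** With [newton_cst * D <= 1/2] the defect at least halves at each step, so the corrections are
    summable. Their total is at most [2 * newton_cst * D <= 1], which keeps every iterate within the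
    bound 2 that [newton_step] requires. *)
Lemma newton_limit f0 D : f0 i0 = 1%:M ->
  (forall i, nu (f0 i) <= 1) -> (forall i j, nu (defect f0 i j) <= D) ->
  newton_cst * D <= 2^-1 ->
  exists f, [/\ f i0 = 1%:M,
    forall i j, f i *m f j = lincomb f (c i j)
    & forall i, nu (f i - f0 i) <= Q * (newton_cst * D)].
Proof.
move=> f01 f0_le f0D CD; set C := newton_cst in CD *.
have C0 : 0 <= C := newton_cst_ge0.
have D0 : 0 <= D := le_trans (nu_ge0 _) (f0D i0 i0).
pose F n := iter n newton f0.
have FP n : [/\ F n i0 = 1%:M,
    forall i, nu (F n i - f0 i) <= 2 * (C * D) * (1 - 2^-1 ^+ n)
    & forall i j, nu (defect (F n) i j) <= D * 2^-1 ^+ n].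
  elim: n => [|n [F1 Ff0 FD]].
    by split=> // [i|i j]; rewrite ?subrr ?nu0 ?mulr0 // expr0 mulr1.
  have e0 : 0 <= (2^-1 : R) ^+ n by rewrite exprn_ge0 // invr_ge0.
  have e1 : (2^-1 : R) ^+ n <= 1 by rewrite exprn_ile1 // ?invr_ge0 // invf_le1 // ler1n.
  have F2 i : nu (F n i) <= 2.
    rewrite -(subrK (f0 i) (F n i)); apply: (le_trans (nuD _ _)).
    apply: (le_trans (lerD (Ff0 i) (f0_le i))); nra.
  have [corr FD'] := newton_step F1 F2 FD.
  split=> [|i|i j]; first exact: newton_unit.
    have -> : F n.+1 i - f0 i = correction (F n) i + (F n i - f0 i).
      by rewrite /= /newton [F n i + _]addrC addrA.
    apply: (le_trans (nuD _ _)); apply: (le_trans (lerD (corr i) (Ff0 i))).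
    rewrite -/C exprS; set e := _ ^+ n.
    by rewrite le_eqVlt; apply/orP; left; apply/eqP; field.
  apply: (le_trans (FD' i j)); rewrite -/C [2^-1 ^+ n.+1]exprS.
  set e := _ ^+ n in e0 e1 *; have De : 0 <= D * e by rewrite mulr_ge0.
  have -> : C * (D * e) ^+ 2 = (C * D) * (e * (D * e)) by ring.
  have -> : D * (2^-1 * e) = 2^-1 * (1 * (D * e)) by field.
  by apply: ler_pM => //; rewrite ?mulr_ge0 //; apply: ler_wpM2r.
have F2 n i : nu (F n i) <= 2.
  have [_ /(_ i) Ff0 _] := FP n.
  have e0 : 0 <= (2^-1 : R) ^+ n by rewrite exprn_ge0 // invr_ge0.
  rewrite -(subrK (f0 i) (F n i)); apply: (le_trans (nuD _ _)).
  apply: (le_trans (lerD Ff0 (f0_le i))).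
  have : 0 <= C * D by rewrite mulr_ge0.
  nra.
have Fcauchy i : exists Z, forall n, nu (Z - F n i) <= Q * (C * D) / 2 ^+ n.
  apply: nu_complete => n; have [F1 _ FD] := FP n.
  have [corr _] := newton_step F1 (F2 n) FD.
  rewrite /= /newton addrC addKr -exprVn -mulrA; exact: corr.
have [f fF] := choice Fcauchy.
exists f; split=> [|i j|i]; last by have := fF i 0; rewrite expr0 divr1.
  apply/eqP; rewrite -subr_eq0; apply/eqP/nu_eq0.
  apply: (@ler_geometric0 _ _ (Q * (C * D))) => n.
  by have [<- _ _] := FP n; apply: fF.
apply/esym/eqP; rewrite -subr_eq0; apply/eqP/nu_eq0.
pose B := Q * (C * D).
(* The defect of the limit is compared with that of the [n]-th iterate: all errors are constants
   divided by [2 ^+ n]. *)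
apply: (@ler_geometric0 _ _
  (\sum_k absv (c i j 0 k) * B + (M * (B * nu (f j)) + M * (2 * B)) + D)) => n.
have [_ _ /(_ i j) FD] := FP n.
have -> : lincomb f (c i j) - f i *m f j = lincomb (fun k => f k - F n k) (c i j)
    - ((f i - F n i) *m f j + F n i *m (f j - F n j)) + defect (F n) i j.
  have -> : lincomb (fun k => f k - F n k) (c i j) = lincomb f (c i j) - lincomb (F n) (c i j).
    by rewrite /lincomb -sumrB; apply: eq_bigr => k _; rewrite scalerBr.
  rewrite mulmxBl mulmxBr /defect.
  move: (lincomb f _) (lincomb (F n) _) (f i *m f j) (F n i *m f j) (F n i *m F n j).
  by move=> *; apply/matrixP => a b; rewrite !mxE; ring.
apply: (le_trans (nuD _ _)); rewrite [leRHS]mulrDl; apply: lerD; last first.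
  by apply: (le_trans FD); rewrite exprVn.
apply: (le_trans (nuD _ _)); rewrite nuN [leRHS]mulrDl; apply: lerD.
  apply: (le_trans (nu_sum _ _)); rewrite mulr_suml; apply: ler_sum => k _.
  by rewrite nuZ -mulrA ler_wpM2l ?absv_ge0 //; apply: fF.
apply: (le_trans (nuD _ _)); rewrite [leRHS]mulrDl; apply: lerD.
  have -> : M * (B * nu (f j)) / 2 ^+ n = M * (B / 2 ^+ n * nu (f j)).
    by rewrite -!mulrA [nu _ * _]mulrC.
  by apply: nuM_le => //; apply: fF.
have -> : M * (2 * B) / 2 ^+ n = M * (2 * (B / 2 ^+ n)) by rewrite -!mulrA.
by apply: nuM_le => //; apply: fF.
Qed.

End Newton.

Lemma absv_sum_near (R : realType) (K : completeValuedFieldType R) (J : finType)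
    (u : nat -> J -> K) (l : J -> K) :
  (forall j, ucvg (fun n (_ : unit) => u n j) (fun=> l j)) ->
  forall e : R, 0 < e -> \forall n \near \oo, \sum_j absv (l j - u n j) < e.
Proof.
move=> ul e e0; pose t := e / (#|J|%:R + 1).
have J0 : 0 < #|J|%:R + 1 :> R by rewrite ltr_wpDl.
have t0 : 0 < t by rewrite divr_gt0.
have : \forall n \near \oo, forall j, absv (u n j - l j) < t.
  apply: filter_forall => j; have [_ /(_ t t0)] := ul j.
  by apply: filterS => n; apply; exact: tt.
apply: filterS => n un; apply: (@le_lt_trans _ _ (#|J|%:R * t)).
  rewrite mulr_natl -sumr_const; apply: ler_sum => j _.
  by rewrite absvBC ltW.
by rewrite /t mulrCA -ltr_pdivlMl // mulVf ?gt_eqF // ltr_pdivrMr // mul1r ltrDl.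
Qed.

(** Newton's method starts from [X] itself, seen as a map from the algebra with constants [c]; its
    defect is the combination of [X] with coefficients [c - c']. The norm is the l1 norm of
    coordinates in [X]. *)
Lemma rigidity (R : realType) (K : completeValuedFieldType R) d
    (c c' : 'I_(d * d) -> 'I_(d * d) -> 'rV[K]_(d * d)) (W : 'M[K]_(d * d))
    (i0 : 'I_(d * d)) (X : 'I_(d * d) -> 'M[K]_d) (M w D : R) :
  (forall i j k, \sum_l c i j 0 l *: c l k = \sum_l c j k 0 l *: c i l) ->
  (forall j, c j i0 = delta_mx 0 j) ->
  \sum_i \sum_j W i j *: c i j = delta_mx 0 i0 ->
  (forall k l i, \sum_j W j l * c i j 0 k = \sum_j W k j * c j i 0 l) ->
  fam_mx X \in unitmx -> X i0 = 1%:M ->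
  (forall i j, X i *m X j = lincomb X (c' i j)) ->
  (forall i j, \sum_k absv (c' i j 0 k) <= M) ->
  \sum_i \sum_j absv (W i j) <= w ->
  (forall i j, \sum_k absv (c i j 0 k - c' i j 0 k) <= D) ->
  newton_cst M w * D <= 2^-1 ->
  exists f : 'I_(d * d) -> 'M[K]_d, [/\ f i0 = 1%:M,
    forall i j, f i *m f j = lincomb f (c i j)
    & forall i k, absv (coords X (f i) 0 k - (1%:M : 'M[K]_(d * d)) i k)
        <= (d * d)%:R * 2 * (newton_cst M w * D)].
Proof.
move=> cA c1 W1 Wc uX X1 XM c'M Ww cD CD.
pose nu A := \sum_k absv (coords X A 0 k).
have nu_ge0 A : 0 <= nu A by apply: sumr_ge0 => k _; apply: absv_ge0.
have nuD A B : nu (A + B) <= nu A + nu B.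
  rewrite /nu -big_split; apply: ler_sum => k _.
  by rewrite linearD mxE; apply: ler_absvD.
have nuZ a A : nu (a *: A) = absv a * nu A.
  rewrite /nu mulr_sumr; apply: eq_bigr => k _.
  by rewrite linearZ mxE absvM.
have M0 : 0 <= M.
  by apply: le_trans (c'M i0 i0); apply: sumr_ge0 => k _; apply: absv_ge0.
have nuM A B : nu (A *m B) <= M * (nu A * nu B).
  rewrite /nu; have -> : coords X (A *m B) = mulc c' (coords X A) (coords X B).
    by apply: (fam_mx_inj uX); rewrite (lincombM _ _ XM) !coordsK.
  move: (coords X A) (coords X B) => a b.
  apply: (@le_trans _ _ (\sum_k \sum_i \sum_j absv (a 0 i) * absv (b 0 j) * absv (c' i j 0 k))).
    apply: ler_sum => k _; rewrite summxE; apply: (le_trans (ler_absv_sum _ _ _)).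
    apply: ler_sum => i _; rewrite summxE; apply: (le_trans (ler_absv_sum _ _ _)).
    by apply: ler_sum => j _; rewrite mxE !absvM.
  rewrite exchange_big mulr_suml mulr_sumr; apply: ler_sum => i _ /=.
  rewrite exchange_big !mulr_sumr; apply: ler_sum => j _ /=.
  rewrite -mulr_sumr [leRHS]mulrC; apply: ler_wpM2l => //.
  by rewrite mulr_ge0 ?absv_ge0.
have nu_eq0 A : nu A <= 0 -> A = 0.
  move=> nuA; rewrite -(coordsK uX A); suff -> : coords X A = 0 by rewrite linear0.
  apply/rowP => k; rewrite [RHS]mxE; apply/absv_eq0/le_anti; rewrite absv_ge0 andbT.
  apply: le_trans nuA; rewrite /nu (bigD1 k) //= lerDl.
  by apply: sumr_ge0 => j _; apply: absv_ge0.
have le_nu A k : absv (coords X A 0 k) <= nu A.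
  rewrite /nu (bigD1 k) //= lerDl.
  by apply: sumr_ge0 => j _; apply: absv_ge0.
have coordsB A B k : coords X (A - B) 0 k = coords X A 0 k - coords X B 0 k.
  have -> : coords X (A - B) = coords X A - coords X B by rewrite linearB.
  by move: (coords X A) (coords X B) => a b; rewrite !mxE.
have coordsX i : coords X (X i) = delta_mx 0 i.
  by rewrite -[X in coords _ X]lincomb_delta lincombK.
(* Limits are taken coordinatewise; each of the [d * d] coordinates contributes twice the geometric
   bound. *)
have nu_complete (Y : nat -> 'M[K]_d) (B : R) :
    (forall n, nu (Y n.+1 - Y n) <= B / 2 ^+ n) ->
    exists Z, forall n, nu (Z - Y n) <= (d * d)%:R * 2 * B / 2 ^+ n.
  move=> YB.
  have lim k : exists l, forall n, absv (l - coords X (Y n) 0 k) <= B * 2 / 2 ^+ n.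
    apply: geometric_limit => n; apply: le_trans (YB n).
    by have := le_nu (Y n.+1 - Y n) k; rewrite coordsB.
  have [l lY] := choice lim; exists (lincomb X (\row_k l k)) => n.
  apply: (@le_trans _ _ (\sum_(k < d * d) B * 2 / 2 ^+ n)).
    apply: ler_sum => k _; by rewrite coordsB lincombK // [X in X - _]mxE lY.
  rewrite sumr_const card_ord -[leLHS]mulr_natl le_eqVlt; apply/orP; left.
  by apply/eqP; rewrite !mulrA; congr (_ / _); rewrite mulrAC.
have nuX i : nu (X i) <= 1.
  rewrite /nu coordsX (bigD1 i) //= mxE !eqxx absv1.
  by rewrite big1 ?addr0 // => k ki; rewrite mxE (negPf ki) andbF absv0.
have XD i j : nu (defect c X i j) <= D.
  apply: le_trans (cD i j); rewrite /defect XM -linearB /nu lincombK //.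
  by apply: ler_sum => k _; rewrite !mxE.
have [f [f1 fM fX]] := newton_limit cA c1 W1 Wc nu_ge0 nuD nuZ nuM nu_eq0 M0 Ww
  nu_complete X1 nuX XD CD.
exists f; split=> // i k; apply: le_trans (fX i).
have := le_nu (f i - X i) k.
rewrite coordsB coordsX.
by rewrite [delta_mx _ _ _ _]mxE [1%:M i k]mxE eqxx eq_sym.
Qed.

(** * Representations whose traces differ by a bounded function *)

(** Either the linear map [sigma (gs i) |-> sigma0 (gs i)] carries [sigma] to [sigma0], and
    Skolem-Noether conjugates them, or some linear relation valid for [sigma] fails for [sigma0].
    The failure is a nonzero matrix [Z] generating the full matrix algebra as an ideal, which bounds
    the trace. *)
Lemma bounded_trace_dichotomy (R : realType) (K : completeValuedFieldType R)
    (G : groupType) d (gs : 'I_(d * d) -> G) (i0 : 'I_(d * d))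
    (sigma sigma0 : representation G d K) (C : R) :
  gs i0 = 1%g -> fam_mx (sigma \o gs) \in unitmx ->
  fam_mx (sigma0 \o gs) \in unitmx ->
  (forall g, absv (\tr (sigma g) - \tr (sigma0 g)) <= C) ->
  ubounded (fun g => \tr (sigma0 g)) \/
  exists2 P, P \in unitmx & forall g, conj_mx P (sigma g) = sigma0 g.
Proof.
move=> gs0 us us0 tC; pose t g := \tr (sigma g); pose a := trco gs t.
have trt g : \tr (sigma g) = idfun (t g) by [].
have ut : gram gs t \in unitmx by rewrite (gram_unit gs trt).
have sa g : sigma g = lincomb (sigma \o gs) (a g).
  by rewrite {1}(sigma_trco trt ut) map_mx_id.
have [s0a|] := pselect (forall h, sigma0 h = lincomb (sigma0 \o gs) (a h)).
  right; have [||i j|i j|P uP sP] := @skolem_noether K d (sigma0 \o gs) (sigma \o gs)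
      (trsc gs t) i0 us0.
  - by rewrite /= gs0 repr_mx1.
  - by rewrite /= gs0 repr_mx1.
  - by rewrite /= -repr_mxM s0a.
  - by rewrite /= -repr_mxM sa.
  exists P => // g; rewrite /conj_mx sa s0a -mulmxA.
  suff -> : lincomb (sigma \o gs) (a g) *m P = P *m lincomb (sigma0 \o gs) (a g).
    by rewrite mulKmx.
  rewrite mulmx_suml mulmx_sumr; apply: eq_bigr => k _.
  by rewrite -scalemxAl sP -scalemxAr.
move=> /existsNP[h /eqP s0h]; left.
pose Z := sigma0 h - lincomb (sigma0 \o gs) (a h).
have [k [l Zkl]] : exists k l, Z k l != 0.
  apply: contrapT => Z0; move/eqP: s0h; apply; apply/eqP; rewrite -subr_eq0.
  apply/eqP/matrixP => k l; rewrite [RHS]mxE; apply/eqP/negPn/negP => Zkl.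
  by apply: Z0; exists k, l.
pose C1 := C + \sum_i absv (a h 0 i) * C.
(* The same combination formed with [sigma] vanishes, so this trace is a combination of differences
   of traces, with coefficients independent of [x] and [y]. *)
have ZC x y : absv (\tr (sigma0 x *m Z *m sigma0 y)) <= C1.
  pose D g := \tr (sigma g) - \tr (sigma0 g).
  have -> : \tr (sigma0 x *m Z *m sigma0 y)
      = - D (x * h * y)%g + \sum_i a h 0 i * D (x * gs i * y)%g.
    have tr_lin (s : representation G d K) :
        \tr (s x *m (s h - lincomb (s \o gs) (a h)) *m s y)
        = \tr (s (x * h * y)%g) - \sum_i a h 0 i * \tr (s (x * gs i * y)%g).
      rewrite mulmxBr mulmxBl raddfB /= !repr_mxM; congr (_ - _).
      rewrite mulmx_sumr mulmx_suml raddf_sum; apply: eq_bigr => i _ /=.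
      by rewrite -scalemxAr -scalemxAl mxtraceZ !repr_mxM.
    have := tr_lin sigma; rewrite -sa subrr mulmx0 mul0mx raddf0 /= => t0.
    rewrite tr_lin /D; under [X in _ = _ + X]eq_bigr do rewrite mulrBr.
    rewrite sumrB; move/esym/eqP: t0; rewrite subr_eq0 => /eqP ->.
    by rewrite opprB addrA subrK.
  apply: (le_trans (ler_absvD _ _)); apply: lerD; first by rewrite absvN; apply: tC.
  apply: (le_trans (ler_absv_sum _ _ _)); apply: ler_sum => i _.
  by rewrite absvM ler_wpM2l ?absv_ge0 //; apply: tC.
pose u b := coords (sigma0 \o gs) (delta_mx b k).
pose v b := coords (sigma0 \o gs) (delta_mx l b).
(* The identity is written as a sum of products [A Z B], with [A] and [B] expanded in the basis
   [sigma0 \o gs]; the number of terms and the coefficients do not depend on [g]. *)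
have -> : (fun g => \tr (sigma0 g)) = (fun g => \sum_b (Z k l)^-1 *
    \sum_i \sum_j (u b 0 i * v b 0 j) * \tr (sigma0 (g * gs i)%g *m Z *m sigma0 (gs j))).
  apply/funext => g; rewrite -[in LHS](mulmx1 (sigma0 g)) mx1_sum_delta mulmx_sumr.
  rewrite raddf_sum; apply: eq_bigr => b _ /=.
  have -> : delta_mx b b = (Z k l)^-1 *: (delta_mx b k *m Z *m delta_mx l b).
    by rewrite delta_mx_sandwich scalerA mulVf // scale1r.
  rewrite -scalemxAr mxtraceZ; congr (_ * _).
  rewrite -{1}(coordsK us0 (delta_mx b k)) -{1}(coordsK us0 (delta_mx l b)).
  rewrite -/(u b) -/(v b) mulmxA mulmxA.
  have trl A x : \tr (sigma0 g *m lincomb (sigma0 \o gs) x *m A)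
      = \sum_i x 0 i * \tr (sigma0 (g * gs i)%g *m A).
    rewrite mulmx_sumr mulmx_suml raddf_sum; apply: eq_bigr => i _ /=.
    by rewrite -scalemxAr -scalemxAl mxtraceZ repr_mxM.
  have trr A x : \tr (A *m lincomb (sigma0 \o gs) x)
      = \sum_j x 0 j * \tr (A *m sigma0 (gs j)).
    rewrite mulmx_sumr raddf_sum; apply: eq_bigr => i _ /=.
    by rewrite -scalemxAr mxtraceZ.
  rewrite -mulmxA trl; apply: eq_bigr => i _; rewrite mulmxA trr mulr_sumr.
  by apply: eq_bigr => j _; rewrite mulrA.
exists (\sum_b absv (Z k l)^-1 * \sum_i \sum_j absv (u b 0 i * v b 0 j) * C1) => g.
apply: (le_trans (ler_absv_sum _ _ _)); apply: ler_sum => b _.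
rewrite absvM ler_wpM2l ?absv_ge0 //.
apply: (le_trans (ler_absv_sum _ _ _)); apply: ler_sum => i _.
apply: (le_trans (ler_absv_sum _ _ _)); apply: ler_sum => j _.
by rewrite absvM ler_wpM2l ?absv_ge0.
Qed.

(** * Limits of representations *)

(** Allows one element of the basis to be normalised to the identity of the group. *)
Lemma fam_mx_translate (G : groupType) d (F : fieldType)
    (rho : representation G d F) (gs : 'I_(d * d) -> G) h :
  fam_mx (rho \o gs) \in unitmx ->
  fam_mx (rho \o (fun i => h * gs i)%g) \in unitmx.
Proof.
move=> urho; rewrite -row_free_unit; apply: inj_row_free => x.
rewrite -mxvec_lincomb => x0; apply: (fam_mx_inj urho); rewrite linear0.
have : lincomb (rho \o (fun i => h * gs i)%g) x = rho h *m lincomb (rho \o gs) x.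
  rewrite mulmx_sumr; apply: eq_bigr => k _.
  by rewrite -scalemxAr /= repr_mxM.
rewrite (canRL mxvecK x0) linear0 => /esym/(congr1 (mulmx (invmx (rho h)))).
by rewrite mulKmx ?repr_mx_unit // mulmx0.
Qed.

Lemma natr_dim_neq0 (K : fieldType) d : (0 < d)%N ->
  (forall p : nat, p \in [pchar K] -> (d < p)%N) -> d%:R != 0 :> K.
Proof.
move=> d0 charK; apply/negP => dK0; have [p pK] := natf0_pchar d0 dK0.
have := charK p pK; rewrite ltnNge dvdn_leq //.
by rewrite (dvdn_pcharf pK).
Qed.

Section LimitOfRepresentations.
Variables (R : realType) (K : completeValuedFieldType R) (G : groupType) (d : nat).
Variables (L : closedFieldType) (iota : {rmorphism K -> L}).
Variables (rhos : nat -> representation G d K) (rho : representation G d L).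
Variables (T : G -> K) (gs : 'I_(d * d) -> G) (i0 : 'I_(d * d)).
Hypothesis d_neq0 : d%:R != 0 :> K.
Hypothesis gs0 : gs i0 = 1%g.
Hypothesis trT : forall g, \tr (rho g) = iota (T g).
Hypothesis uT : gram gs T \in unitmx.

Let Tn n g := \tr (rhos n g).

Hypothesis TnT : forall g, ucvg (fun n (_ : unit) => Tn n g) (fun=> T g).

Let X n := rhos n \o gs.
Let c := trsc gs T.
Let cn n := trsc gs (Tn n).

Let trTn n g : \tr (rhos n g) = idfun (Tn n g). Proof. by []. Qed.

Lemma gram_near : \forall n \near \oo, gram gs (Tn n) \in unitmx.
Proof.
apply: (@ucvg_unitmx _ _ _ _ (gram gs T)) => // i j.
by apply: ucvg_ext (TnT (gs i * gs j)%g) => *; rewrite mxE.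
Qed.

Lemma fam_mx_near : \forall n \near \oo, fam_mx (X n) \in unitmx.
Proof. by apply: filterS gram_near => n; rewrite (gram_unit gs (trTn n)). Qed.

Lemma rhos_trco n g : gram gs (Tn n) \in unitmx ->
  rhos n g = lincomb (X n) (trco gs (Tn n) g).
Proof. by move=> un; rewrite {1}(sigma_trco (trTn n) un) map_mx_id. Qed.

(** Coordinates are traces times a convergent matrix independent of [j]. The parametrisation [h]
    covers a single element as well as the whole group. *)
Lemma trco_ucvg (J : Type) (h : J -> G) :
  (forall l, ucvg (fun n j => Tn n (h j * gs l)%g) (fun j => T (h j * gs l)%g)) ->
  forall k, ucvg (fun n j => trco gs (Tn n) (h j) 0 k)
                 (fun j => trco gs T (h j) 0 k).
Proof.
move=> hT k.
have gramT i j : ucvg (fun n (_ : unit) => gram gs (Tn n) i j) (fun=> gram gs T i j).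
  by apply: ucvg_ext (TnT (gs i * gs j)%g) => *; rewrite mxE.
suff : ucvg (fun n j => \sum_l Tn n (h j * gs l)%g * invmx (gram gs (Tn n)) l k)
            (fun j => \sum_l T (h j * gs l)%g * invmx (gram gs T) l k).
  by apply: ucvg_ext => *; rewrite mxE; apply: eq_bigr => l _; rewrite mxE.
apply: ucvg_sum => l; apply: ucvgM => //.
exact: (ucvg_reindex (fun=> tt) (ucvg_invmx gramT uT l k)).
Qed.

Lemma trco_cvg g k :
  ucvg (fun n (_ : unit) => trco gs (Tn n) g 0 k) (fun=> trco gs T g 0 k).
Proof. by apply: trco_ucvg => l; apply: TnT. Qed.

Let Dn n := \sum_(p : 'I_(d * d) * 'I_(d * d) * 'I_(d * d))
  absv (c p.1.1 p.1.2 0 p.2 - cn n p.1.1 p.1.2 0 p.2).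

Let Dn_near e : 0 < e -> \forall n \near \oo, Dn n < e.
Proof.
move=> e0; apply: (@absv_sum_near _ _ _
  (fun n p => cn n p.1.1 p.1.2 0 p.2) (fun p => c p.1.1 p.1.2 0 p.2)) => // p.
exact: trco_cvg.
Qed.

Let le_tripleE (F : 'I_(d * d) -> 'I_(d * d) -> 'I_(d * d) -> R) i j :
  (forall a b k, 0 <= F a b k) -> \sum_k F i j k
  <= \sum_(p : 'I_(d * d) * 'I_(d * d) * 'I_(d * d)) F p.1.1 p.1.2 p.2.
Proof.
move=> F0; rewrite -(pair_bigA _ (fun p k => F p.1 p.2 k)) /=.
rewrite (bigD1 (i, j)) //= lerDl; apply: sumr_ge0 => p _.
by apply: sumr_ge0.
Qed.

(** Bounds the structure constants of the [n]-th algebra as soon as [Dn n < 1]. *)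
Let M := 1 + \sum_(p : 'I_(d * d) * 'I_(d * d) * 'I_(d * d))
  absv (c p.1.1 p.1.2 0 p.2).
Let w := \sum_i \sum_j absv (sepW gs T i j).
Let C := newton_cst M w.

(** [f] is an algebra morphism from the limit algebra, close to the map with values [X n]. *)
Let good n (f : 'I_(d * d) -> 'M[K]_d) := [/\ f i0 = 1%:M,
  forall i j, f i *m f j = lincomb f (c i j)
  & forall i k, absv (coords (X n) (f i) 0 k - (1%:M : 'M[K]_(d * d)) i k)
      <= (d * d)%:R * 2 * (C * Dn n)].

Lemma good_near : \forall n \near \oo, exists f, good n f.
Proof.
have M0 : 0 <= M by rewrite addr_ge0 // sumr_ge0 // => p _; apply: absv_ge0.
have w0 : 0 <= w.
  by apply: sumr_ge0 => i _; apply: sumr_ge0 => j _; apply: absv_ge0.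
have C0 : 0 <= C by apply: newton_cst_ge0 M0 (lexx w).
(* Ensures [C * Dn n <= 1/2]; adding 1 avoids dividing by zero. *)
have t0 : 0 < 2^-1 / (C + 1) by rewrite divr_gt0 ?invr_gt0 // ltr_wpDl.
apply: filterS3 gram_near (Dn_near ltr01) (Dn_near t0) => n un D1 Dt.
have cD i j : \sum_k absv (c i j 0 k - cn n i j 0 k) <= Dn n.
  by apply: (@le_tripleE (fun i j k => absv (c i j 0 k - cn n i j 0 k))) => *; apply: absv_ge0.
have uX : fam_mx (X n) \in unitmx by rewrite -(gram_unit gs (trTn n)).
apply: (@rigidity _ _ _ c (cn n) (sepW gs T) i0 (X n) M w (Dn n)) => //.
- exact: (trsc_assoc trT uT).
- by move=> j; rewrite /c /trsc gs0 mulg1 trco_gs.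
- exact: (sepW_unit trT uT).
- by move=> k l i; apply: (sepW_trsc gs trT).
- by rewrite /X /= gs0 repr_mx1.
- by move=> i j; rewrite /X /= -repr_mxM rhos_trco.
- move=> i j; apply: (@le_trans _ _ (\sum_k (absv (c i j 0 k - cn n i j 0 k) + absv (c i j 0 k)))).
    apply: ler_sum => k _; rewrite absvBC -{1}[cn n i j 0 k](subrK (c i j 0 k)).
    exact: ler_absvD.
  rewrite big_split; apply: lerD; first exact: le_trans (cD i j) (ltW D1).
  by apply: (@le_tripleE (fun i j k => absv (c i j 0 k))) => *; apply: absv_ge0.
have Dn0 : 0 <= Dn n by apply: sumr_ge0 => p _; apply: absv_ge0.
move: Dt; rewrite ltr_pdivlMr ?ltr_wpDl // mulrDr mulr1 mulrC => /ltW.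
by apply: le_trans; rewrite lerDl.
Qed.

Lemma physical_limit :
  exists (rho0 : representation G d K) (P : nat -> 'M[K]_d),
  [/\ fam_mx (rho0 \o gs) \in unitmx,
      exists2 Q, Q \in unitmx &
        forall g, conj_mx Q (rho g) = extend_scalars iota rho0 g,
      forall n, P n \in unitmx
    & forall (J : Type) (h : J -> G),
      (forall l, ucvg (fun n j => Tn n (h j * gs l)%g)
                      (fun j => T (h j * gs l)%g)) ->
      forall a b, ucvg (fun n j => conj_mx (P n) (rhos n (h j)) a b)
                       (fun j => rho0 (h j) a b)].
Proof.
have [f fgood] : exists f : nat -> 'I_(d * d) -> 'M[K]_d,
    \forall n \near \oo, good n (f n).
  have [n0 _ n0P] := good_near.
  have ex_f n : exists f, (n0 <= n)%N -> good n f.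
    have [/n0P[f fP]|] := leqP n0 n; first by exists f.
    by exists (fun=> 0).
  have [f fP] := choice ex_f; exists f; exists n0 => // n /= /fP.
(* The matrix of [f n] in the basis [X n]. It tends to the identity, so [f n] is eventually a basis
   and the change of coordinates tends to the identity. *)
pose Phi n := \matrix_i coords (X n) (f n i) : 'M[K]_(d * d).
have Phi1 i k : ucvg (fun n (_ : unit) => Phi n i k)
    (fun=> (1%:M : 'M[K]_(d * d)) i k).
  split; first exact: ubounded_cst.
  move=> e e0; pose q := (d * d)%:R * 2 * C.
  have q0 : 0 < `|q| + 1 by rewrite ltr_wpDl.
  have t0 : 0 < e / (`|q| + 1) by rewrite divr_gt0.
  apply: filterS2 fgood (Dn_near t0) => n [_ _ fn] Dt _.
  have -> : Phi n i k = coords (X n) (f n i) 0 k by rewrite [LHS]mxE.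
  have Dn0 : 0 <= Dn n by apply: sumr_ge0 => p _; apply: absv_ge0.
  apply: (le_lt_trans (fn i k)); rewrite mulrA -/q.
  rewrite (le_lt_trans (ler_wpM2r Dn0 (ler_norm q))) //.
  move: Dt; rewrite ltr_pdivlMr // mulrC; apply: le_lt_trans.
  by rewrite ler_wpM2r // lerDl.
have PhiU : \forall n \near \oo, Phi n \in unitmx.
  exact: ucvg_unitmx Phi1 (unitmx1 _ _).
have [m _ mP] : \forall n \near \oo,
    [/\ gram gs (Tn n) \in unitmx, good n (f n) & Phi n \in unitmx].
  by apply: filterS3 gram_near fgood PhiU => n *; split.
have uX n : (m <= n)%N -> fam_mx (X n) \in unitmx.
  by move=> /mP[un _ _]; rewrite -(gram_unit gs (trTn n)).
have famf n : (m <= n)%N -> fam_mx (f n) = Phi n *m fam_mx (X n).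
  move=> mn; apply/row_matrixP => i; rewrite row_mul !rowK -mxvec_lincomb coordsK //.
  exact: uX.
have [_ [f1 fM _] _] := mP m (leqnn m).
have uf : fam_mx (f m) \in unitmx.
  by rewrite famf // unitmx_mul uX // andbT; have [] := mP m (leqnn m).
have rho01 : lincomb (f m) (trco gs T 1%g) = 1%:M.
  by rewrite -gs0 trco_gs // lincomb_delta.
have rho0M g h : lincomb (f m) (trco gs T (g * h)%g)
    = lincomb (f m) (trco gs T g) *m lincomb (f m) (trco gs T h).
  by rewrite (trcoM trT uT) (lincombM _ _ fM).
(* The limit coordinates are multiplicative for the constants [c], which [f m] realises by matrices
   over [K]. *)
pose rho0 := Representation rho01 rho0M.
have rho0gs i : rho0 (gs i) = f m i by rewrite /= trco_gs // lincomb_delta.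
have exP n : exists P, P \in unitmx /\
    ((m <= n)%N -> forall i, f n i *m P = P *m f m i).
  have [mn|] := leqP m n; last by exists 1%:M; rewrite unitmx1.
  have [_ [fn1 fnM _] _] := mP n mn.
  by have [P uP fP] := skolem_noether uf f1 fn1 fM fnM; exists P.
have [P PP] := choice exP.
exists rho0, P; split.
- have -> : fam_mx (rho0 \o gs) = fam_mx (f m); last by [].
  by apply/row_matrixP => i; rewrite !rowK /= -rho0gs.
(* Over [L], the families [f m] and [rho \o gs] have the same structure constants, so Skolem-Noether
   conjugates [rho] to [rho0]. *)
- pose Y i := map_mx iota (f m i).
  have uY : fam_mx Y \in unitmx.
    have -> : fam_mx Y = map_mx iota (fam_mx (f m)); last by rewrite map_unitmx.
    by apply/row_matrixP => i; rewrite -map_row !rowK map_mxvec.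
  have [||i j|i j|Q uQ QP] := @skolem_noether L d Y (rho \o gs)
      (fun i j => map_mx iota (c i j)) i0 uY.
  + by rewrite /Y f1 map_mx1.
  + by rewrite /= gs0 repr_mx1.
  + by rewrite /Y -map_mxM fM map_lincomb.
  + exact: (sigma_trsc trT uT).
  exists Q => // g; rewrite /conj_mx (sigma_trco trT uT) /= map_lincomb -mulmxA.
  set x := map_mx iota _.
  suff -> : lincomb (rho \o gs) x *m Q = Q *m lincomb Y x by rewrite mulKmx.
  rewrite mulmx_suml mulmx_sumr; apply: eq_bigr => k _.
  by rewrite -scalemxAl QP -scalemxAr.
- by move=> n; case: (PP n).
move=> J h hT a b.
(* Conjugation by [P n] turns the moving basis [f n] into the fixed [f m], so that only coordinates
   depend on [n]; they are [trco] times the inverse of [Phi n]. *)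
apply: (@ucvg_near _ _ _ (fun n j => \sum_k
    (\sum_l trco gs (Tn n) (h j) 0 l * invmx (Phi n) l k) * f m k a b)).
  exists m => // n /= mn j; have [un _ uPhi] := mP n mn.
  have [uP /(_ mn) fP] := PP n.
  pose y := trco gs (Tn n) (h j) *m invmx (Phi n).
  have -> : rhos n (h j) = lincomb (f n) y.
    apply: (can_inj mxvecK); rewrite mxvec_lincomb famf // mulmxA mulmxKV //.
    by rewrite -mxvec_lincomb -rhos_trco.
  have -> : conj_mx (P n) (lincomb (f n) y) = lincomb (f m) y.
    rewrite /conj_mx -mulmxA.
    suff -> : lincomb (f n) y *m P n = P n *m lincomb (f m) y by rewrite mulKmx.
    rewrite mulmx_suml mulmx_sumr; apply: eq_bigr => k _.
    by rewrite -scalemxAl fP -scalemxAr.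
  rewrite summxE; apply: eq_bigr => k _.
  by rewrite [RHS]mxE; congr (_ * _); rewrite mxE.
apply: (@ucvg_ext _ _ _ _ _ (fun j => \sum_k
    (\sum_l trco gs T (h j) 0 l * (invmx 1%:M : 'M[K]_(d * d)) l k) * f m k a b)) => [//|j|].
  rewrite /= summxE; apply: eq_bigr => k _; rewrite [RHS]mxE; congr (_ * _).
  by rewrite invmx1 -[in RHS](mulmx1 (trco _ _ _)) [RHS]mxE.
apply: ucvg_sum => k; apply: ucvgM; last exact/ucvg_cst/ubounded_cst.
apply: ucvg_sum => l; apply: ucvgM; first exact: trco_ucvg.
exact: (ucvg_reindex (fun=> tt) (ucvg_invmx Phi1 (unitmx1 _ _) l k)).
Qed.

End LimitOfRepresentations.

Theorem theorem1p2 (R : realType) (K : completeValuedFieldType R)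
    (G : groupType) (d : nat)
    (L : closedFieldType) (iota : {rmorphism K -> L})
    (rhos : nat -> representation G d K) (rho : representation G d L) :
  nontrivially_valued K ->
  algebraic_closure iota ->
  (1 <= d)%N ->
  (forall p : nat, p \in [pchar K] -> (d < p)%N) ->
  trace_convergent rhos ->
  limit_representation iota rhos rho ->
  irreducible rho ->
  [/\ \forall n \near \oo, absolutely_irreducible (rhos n),
      physically_convergent rhos,
      defined_over iota rho
    & uniformly_trace_convergent rhos -> uniformly_physically_convergent rhos].
Proof.
move=> _ _ d_gt0 charK tcvg [_ trT] irr.
set T := limit_trace rhos in trT.
(* Any fixed index serves as [i0]; translating Burnside's family makes its element at [i0] the
   identity. *)
pose k0 := Ordinal d_gt0; pose i0 := mxvec_index k0 k0.
have [gs' ugs'] := burnside irr.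
pose gs i := ((gs' i0)^-1 * gs' i)%g.
have gs0 : gs i0 = 1%g by rewrite /gs mulVg.
have ugs : fam_mx (rho \o gs) \in unitmx := fam_mx_translate _ ugs'.
have uT : gram gs T \in unitmx by rewrite (gram_unit gs trT).
have d_neq0 := natr_dim_neq0 d_gt0 charK.
have TnT g : ucvg (fun n (_ : unit) => \tr (rhos n g)) (fun=> T g).
  exact/ucvg_unitP/tcvg.
have ufam := fam_mx_near uT TnT.
have [rho0 [P [u0 [Q uQ QP] uP PP]]] := physical_limit d_neq0 gs0 trT uT TnT.
split.
- by apply: filterS ufam => n; apply: fam_mx_absolutely_irreducible.
- exists P; split=> // g a b; apply/cvg_ex; exists (rho0 g a b).
  by apply/ucvg_unitP; apply: (PP unit (fun=> g)) => l; apply: TnT.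
- by exists rho0, Q.
move=> [T' /uniform_absvP TT'].
(* The uniform limit agrees with the pointwise one. *)
have T'T g : T' g = T g.
  apply/eqP; rewrite -subr_eq0; apply/eqP/absv_eq0/le_anti; rewrite absv_ge0 andbT.
  apply/ler_addgt0Pr => e e0; rewrite add0r.
  have e2 : 0 < e / 2 by rewrite divr_gt0.
  have [_ /(_ _ e2) Tg] := TnT g.
  near \oo => n; have Tn : absv (\tr (rhos n g) - T g) < e / 2.
    by near: n; apply: filterS Tg => n; apply; exact: tt.
  have Tn' : absv (\tr (rhos n g) - T' g) < e / 2.
    by near: n; apply: filterS (TT' _ e2) => n; apply.
  rewrite -(subrK (\tr (rhos n g)) (T' g)) -addrA [e]splitr.
  by apply: (le_trans (ler_absvD _ _)); rewrite lerD ?ltW // absvBC.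
have uTn e : 0 < e -> \forall n \near \oo, forall g, absv (\tr (rhos n g) - T g) < e.
  by move=> /TT'; apply: filterS => n Tn g; rewrite -T'T.
(* For bounded [T] the trace functions satisfy [ucvg] over all of [G], and the same [P] works. *)
have [bT|ubT] := pselect (ubounded T).
  exists P; split=> // a b; exists (fun g => rho0 g a b).
  apply/uniform_absvP => e; have [_] : ucvg
      (fun n g => conj_mx (P n) (rhos n g) a b) (fun g => rho0 g a b); last exact.
  apply: (PP G id) => l; have uT' : ucvg (fun n g => \tr (rhos n g)) T by [].
  exact: (ucvg_reindex (fun g => g * gs l)%g uT').
have tr0 g : \tr (rho0 g) = T g.
  apply: (fmorph_inj iota); rewrite -trT -trace_map_mx.
  have -> : map_mx iota (rho0 g) = conj_mx Q (rho g) by rewrite QP.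
  by rewrite /conj_mx mxtrace_mulC mulKVmx.
(* For unbounded [T], traces within distance 1 of [T] already force [rhos n] to be conjugate to
   [rho0]; the conjugated sequence is then eventually constant. *)
have exP : \forall n \near \oo, exists P,
    P \in unitmx /\ forall g, conj_mx P (rhos n g) = rho0 g.
  apply: filterS2 ufam (uTn 1 ltr01) => n un Tn.
  have [|bT|[P' uP' P'P]] := @bounded_trace_dichotomy _ _ _ _ gs i0 (rhos n) rho0 1 gs0 un u0.
  - by move=> g; rewrite tr0 ltW.
  - by case: ubT; rewrite -(funext tr0).
  - by exists P'.
have [n0 _ n0P] := exP.
have ex_P n : exists P, P \in unitmx /\
    ((n0 <= n)%N -> forall g, conj_mx P (rhos n g) = rho0 g).
  have [/n0P[P' [uP' P'P]]|] := leqP n0 n; first by exists P'.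
  by exists 1%:M; rewrite unitmx1.
have [P' P'P] := choice ex_P; exists P'; split=> [n|a b]; first by case: (P'P n).
exists (fun g => rho0 g a b); apply/uniform_absvP => e e0.
exists n0 => // n /= n0n g; have [_ /(_ n0n) ->] := P'P n.
by rewrite subrr absv0.
Unshelve. all: by end_near. Qed.
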